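(* The embeddability relation $\sqsubseteq_{Gp}$ on the standard Borel space of countable groups is a universal analytic quasi-order: it is an analytic quasi-order, and every analytic quasi-order on a standard Borel space Borel reduces to it.
   Context: The space of countable groups is the standard Borel space of group structures on $\mathbb{N}$ (coded, e.g., by the graph of the multiplication as an element of $2^{\mathbb{N}^3}$). For groups $G,H$ in this space, $G\sqsubseteq_{Gp}H$ iff there is an injective group homomorphism $G\to H$. An analytic quasi-order is a quasi-order on a standard Borel space that is analytic as a subset of the square. For quasi-orders $Q$ on $X$ and $Q'$ on $Y$, $Q\leq_B Q'$ means there is a Borel $f\colon X\to Y$ with $x\mathbin{Q}y\Leftrightarrow f(x)\mathbin{Q'}f(y)$; an analytic quasi-order is universal if every analytic quasi-order Borel reduces to it. *)

(* Defs.v *)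
From HB Require Import structures.
From Stdlib Require PeanoNat.
From mathcomp Require Import all_boot all_order all_algebra.
From mathcomp Require Import all_classical all_reals all_analysis.

Set Implicit Arguments.
Unset Strict Implicit.
Unset Printing Implicit Defensive.

Import Order.TTheory GRing.Theory Num.Theory.
Local Open Scope classical_set_scope.
Local Open Scope ring_scope.

(* A Polish space, presented with a compatible complete metric. *)
Definition polish (R : realType) (Y : metricType R) : Prop :=
  (exists2 D : set Y, countable D & dense D) /\
  (forall u : nat -> Y, cauchy (u @ \oo) -> exists l : Y, u @ \oo --> l).

(* f is an isomorphism of measurable spaces onto Y with its Borel sets. *)
Definition standard_borel (R : realType) (d : measure_display)
    (T : measurableType d) : Prop :=
  exists (Y : metricType R) (f : T -> Y),
    [/\ polish Y, bijective f &
      forall B : set Y, <<s @open Y >> B <-> measurable (f @^-1` B)].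

(* Projections of Borel sets along a standard Borel factor. *)
Definition analytic (R : realType) (d : measure_display) (T : measurableType d)
    (A : set T) : Prop :=
  exists (d' : measure_display) (Y : measurableType d'),
    standard_borel R Y /\
    exists2 B : set (T * Y), measurable B & A = fst @` B.

Definition analytic_quasi_order (R : realType) (d : measure_display)
    (T : measurableType d) (Q : T -> T -> Prop) : Prop :=
  [/\ standard_borel R T,
      forall x, Q x x,
      forall x y z, Q x y -> Q y z -> Q x z &
      analytic R [set p : T * T | Q p.1 p.2]].

Definition borel_reducible (d d' : measure_display) (X : measurableType d)
    (Y : measurableType d') (Q : X -> X -> Prop) (Q' : Y -> Y -> Prop) : Prop :=
  exists2 f : X -> Y, measurable_fun [set: X] f &
    forall x y, Q x y <-> Q' (f x) (f y).

Definition universal_analytic_quasi_order (R : realType) (d : measure_display)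
    (T : measurableType d) (Q : T -> T -> Prop) : Prop :=
  analytic_quasi_order R Q /\
  forall (d' : measure_display) (X : measurableType d') (P : X -> X -> Prop),
    analytic_quasi_order R P -> borel_reducible P Q.

Definition group_law (mul : nat -> nat -> nat) : Prop :=
  associative mul /\
  exists e, [/\ left_id e mul, right_id e mul &
    forall x, exists y, mul y x = e /\ mul x y = e].

(* 2^(N^3) with the product of the discrete topologies. *)
Definition cantor_N3 := prod_topology (fun _ : nat * nat * nat => bool).

Definition group_graphs : set cantor_N3 :=
  [set g | exists2 mul, group_law mul &
    forall x y z, g (x, y, z) = (mul x y == z)].

(* measurableType requires a point; any group structure on nat would do. *)
Lemma lxor_group_graph :
  (fun t => PeanoNat.Nat.lxor t.1.1 t.1.2 == t.2) \in group_graphs.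
Proof.
apply/mem_set; exists PeanoNat.Nat.lxor => //; split.
  by move=> x y z; rewrite PeanoNat.Nat.lxor_assoc.
exists 0%N; split; first exact: PeanoNat.Nat.lxor_0_l.
  exact: PeanoNat.Nat.lxor_0_r.
by move=> x; exists x; rewrite PeanoNat.Nat.lxor_nilpotent.
Qed.

Definition group_space : Type := set_type group_graphs.

HB.instance Definition _ := Choice.on group_space.
HB.instance Definition _ := isPointed.Build group_space
  (exist (fun g => g \in group_graphs) _ lxor_group_graph).

(* The Borel sets of the subspace topology inherited from 2^(N^3). *)
Definition group_space_borel : set (set group_space) :=
  <<s @open (set_type group_graphs) >>.

HB.instance Definition _ := @isMeasurable.Build
  (sigma_display group_space_borel) group_space group_space_borel
  (@sigma_algebra0 _ setT _) (@sigma_algebraC group_space _)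
  (@sigma_algebra_bigcup _ setT _).

Definition graph_of (G : group_space) : nat * nat * nat -> bool :=
  @set_val _ group_graphs G.

(* Since graph_of G (x, y, z) means x * y = z in G, the second condition says
   that f is a group homomorphism. *)
Definition group_embeddable (G H : group_space) : Prop :=
  exists2 f : nat -> nat, injective f &
    forall x y z, graph_of G (x, y, z) -> graph_of H (f x, f y, f z).

(* Main.v *)
From HB Require Import structures.
Require Import Defs.
From mathcomp Require Import all_boot all_order all_algebra.
From mathcomp Require Import all_classical all_reals all_analysis.
From mathcomp Require Import ring lra.

Set Implicit Arguments.
Unset Strict Implicit.
Unset Printing Implicit Defensive.

Import Order.TTheory GRing.Theory Num.Theory.
Local Open Scope classical_set_scope.
Local Open Scope ring_scope.

(** Torsion-free abelian groups already suffice.  Let P be an analytic quasi-order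
    on X.  There are an injective Borel map phi from X to the Baire space and a
    closed relation K such that K g b holds for some g with first component a
    iff a = phi x and b = phi y with P x y.  To x attach the forest of finite
    approximations of K-chains ending at phi x: a node of level n lists the first
    n values of every link of a chain, and is labelled by the first n values of
    the point at which the chain starts.  If P x y, appending a witness of P x y
    to every chain embeds the forest of x into that of y.  Conversely, the chain
    of length 0 at phi x is a branch of the forest of x, and a branch with the
    same labels in the forest of y is a true K-chain from phi x to phi y, so that
    P x y holds by transitivity.

    The forest is coded by a subgroup of a rational vector space with one basis
    vector e_s per node s, in which e_s is divisible by all powers of a prime
    attached to the label of s, and e_s - e_(parent s) by all powers of a prime
    attached to the level of s.  An embedding of the group of x into that of y
    sends the branch of x to vectors v_n in the span of the nodes with the
    prescribed label, and divisibility of v_(n+1) - v_n says that each coefficient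
    of v_n is the sum of the coefficients of v_(n+1) at the children.  As v_0 is
    nonzero, some branch of the forest of y carries nonzero coefficients. *)

(** * Groups coding labelled forests *)

(** For prime [p], the localisation of the integers at [p]. *)
Definition local_int (p : nat) : set rat :=
  [set q | exists2 m : nat, ~~ (p %| m)%N & q * m%:R \is a Num.int].

Section LocalIntegers.
Variables (p : nat) (p_prime : prime p).

Lemma local_int_int (q : rat) : q \is a Num.int -> local_int p q.
Proof.
move=> qZ; exists 1%N; last by rewrite mulr1.
by rewrite dvdn1; apply: contraL p_prime => /eqP ->.
Qed.

Lemma local_int0 : local_int p 0.
Proof. exact/local_int_int/rpred0. Qed.

Lemma local_intD (q r : rat) :
  local_int p q -> local_int p r -> local_int p (q + r).
Proof.
move=> [m pm qm] [n pn rn]; exists (m * n)%N.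
  by rewrite Euclid_dvdM // negb_or pm.
rewrite natrM mulrDl mulrA [r * _]mulrCA [r * _]mulrC [m%:R * _]mulrC.
rewrite rpredD // rpredM ?natr_int //.
by rewrite mulrC.
Qed.

Lemma local_intM (q r : rat) :
  local_int p q -> r \is a Num.int -> local_int p (q * r).
Proof. by move=> [m pm qm] rZ; exists m => //; rewrite mulrAC rpredM. Qed.

Lemma local_int_div_prime (z : int) (p' k : nat) :
  prime p' -> p' != p -> local_int p (z%:~R / p'%:R ^+ k).
Proof.
move=> pp' neq; exists (p' ^ k)%N.
  by rewrite Euclid_dvdX // negb_and dvdn_prime2 // eq_sym neq.
by rewrite natrX mulfVK ?intr_int// expf_neq0// pnatr_eq0; case: p' pp' {neq}.
Qed.

(** Denominators are prime to [p], so every power of [p] divides the numerator of [q], which must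
    then vanish. *)
Lemma local_int_divisible (q : rat) :
  (forall k, exists2 r, local_int p r & q = r * p%:R ^+ k) -> q = 0.
Proof.
move=> H; apply/eqP; rewrite -numq_eq0 -absz_eq0.
have dv k : (p ^ k %| `|numq q|)%N.
  have [r [m pm /intrP[z rm]] qE] := H k.
  have : (numq q * m%:Z = z * (p ^ k)%N%:Z * denq q)%R.
    apply/eqP; rewrite -(eqr_int rat) !rmorphM /= numqE -rm qE.
    by rewrite -!pmulrn natrX; apply/eqP; ring.
  move/(congr1 absz); rewrite !abszM !absz_nat => E.
  have : (p ^ k %| `|numq q| * m)%N by rewrite E mulnAC dvdn_mull.
  by rewrite Gauss_dvdl// coprimeXl// prime_coprime.
have [/eqP//|q0] := posnP `|numq q|%N.
have := dvdn_leq q0 (dv `|numq q|%N).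
by rewrite leqNgt ltn_expl// prime_gt1.
Qed.

End LocalIntegers.

(** Only distinctness matters: [prime_above] returns some larger prime, so primes may be skipped. *)
Fixpoint nth_prime (n : nat) : nat :=
  if n is m.+1 then s2val (prime_above (nth_prime m)) else 2.

Lemma nth_prime_prime n : prime (nth_prime n).
Proof. by case: n => //= n; case: prime_above. Qed.

Lemma nth_prime_inj : injective nth_prime.
Proof.
apply: incn_inj; apply: leq_mono; apply: homo_ltn; first exact: ltn_trans.
by move=> i /=; case: prime_above.
Qed.

(* The linear map on [{poly rat}] that sends ['X^i] to [w i]. *)
Definition linear_ext (V : lmodType rat) (w : nat -> V) (v : {poly rat}) : V :=
  \sum_(i < size v) v`_i *: w i.

Section LinearExt.
Variables (V : lmodType rat) (w : nat -> V).

Lemma linear_ext_widen n (v : {poly rat}) : (size v <= n)%N ->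
  linear_ext w v = \sum_(i < n) v`_i *: w i.
Proof.
move=> vn; rewrite /linear_ext (big_ord_widen n (fun i => v`_i *: w i))//.
rewrite big_mkcond; apply: eq_bigr => i _.
by case: ltnP => // /(nth_default 0) ->; rewrite scale0r.
Qed.

Lemma linear_ext_is_linear : linear (linear_ext w).
Proof.
move=> a u v; set n := maxn (size u) (size v).
have un : (size u <= n)%N := leq_maxl _ _.
have vn : (size v <= n)%N := leq_maxr _ _.
rewrite (@linear_ext_widen n) 1?(linear_ext_widen un) 1?(linear_ext_widen vn).
  rewrite scaler_sumr -big_split; apply: eq_bigr => i _.
  by rewrite coefD coefZ scalerDl scalerA.
apply: leq_trans (size_polyD _ _) _; rewrite geq_max vn andbT.
by apply: leq_trans un; exact: size_scale_leq.
Qed.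

HB.instance Definition _ :=
  GRing.isLinear.Build rat {poly rat} V _ (linear_ext w) linear_ext_is_linear.

Lemma linear_extXn i : linear_ext w 'X^i = w i.
Proof.
rewrite /linear_ext size_polyXn big_ord_recr big1 /= ?add0r.
  by rewrite coefXn eqxx scale1r.
by move=> j _; rewrite coefXn ltn_eqF// scale0r.
Qed.

End LinearExt.

Lemma linear_ext_neq0 (w : nat -> rat^o) (v : {poly rat}) :
  linear_ext w v != 0 -> exists2 i, v`_i != 0 & w i != 0.
Proof.
move=> /eqP H; apply: contrapT => K; apply: H.
apply: big1 => i _; case: (eqVneq v`_i 0) => [->|vi]; first by rewrite scale0r.
case: (eqVneq (w i) 0) => [->|wi]; first by rewrite scaler0.
by case: K; exists i.
Qed.

(** * The group of a labelled forest *)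

Section ForestGroup.
Variables (N L : countType) (lev : N -> nat) (par : N -> N).
Implicit Types (M : N -> L -> Prop) (s : N) (l : L).

(** The disjoint union ensures that no label shares its prime with a level. *)
Definition prime_of (t : L + nat) : nat := nth_prime (pickle t).

Lemma prime_of_prime t : prime (prime_of t).
Proof. exact: nth_prime_prime. Qed.

Lemma prime_of_eq t u : (prime_of t == prime_of u) = (t == u).
Proof.
apply/eqP/eqP => [|->//].
by move/nth_prime_inj/(pcan_inj (@pickleK (L + nat)%type)).
Qed.

(** The basis vector e_s; polynomials serve as a countable rational vector space with a basis
    indexed by [nat]. *)
Definition monom s : {poly rat} := 'X^(pickle s).

(** The boolean chooses between e_s and e_s - e_(parent s), to be multiplied by [z / p ^ k]. Letting
    [z] run over all integers makes the finite sums of generators closed under negation. *)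
Definition gen_index : Type := (bool * N * L * int * nat)%type.

Definition gen (g : gen_index) : {poly rat} :=
  let: (b, s, l, z, k) := g in
  if b then (z%:~R / (prime_of (inl l))%:R ^+ k) *: monom s
  else (z%:~R / (prime_of (inr (lev s)))%:R ^+ k) *: (monom s - monom (par s)).

Definition gen_valid M (g : gen_index) : Prop := M g.1.1.1.2 g.1.1.2.

Definition forest_group M : set {poly rat} :=
  [set v | exists2 r : seq gen_index,
    (forall g, g \in r -> gen_valid M g) & v = \sum_(g <- r) gen g].

Lemma forest_group_ind M (K : set {poly rat}) :
  K 0 -> (forall u v, K u -> K v -> K (u + v)) ->
  (forall g, gen_valid M g -> K (gen g)) -> forest_group M `<=` K.
Proof.
move=> K0 KD Kg _ [r rM ->]; rewrite big_seq.
by apply: big_ind => // g /rM; exact: Kg.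
Qed.

Lemma forest_group_gen M g : gen_valid M g -> forest_group M (gen g).
Proof.
by move=> Mg; exists [:: g]; rewrite ?big_seq1// => h; rewrite inE => /eqP ->.
Qed.

Lemma forest_group0 M : forest_group M 0.
Proof. by exists [::]; rewrite ?big_nil. Qed.

Lemma forest_groupD M u v :
  forest_group M u -> forest_group M v -> forest_group M (u + v).
Proof.
move=> [r rM ->] [r' rM' ->]; exists (r ++ r'); last by rewrite big_cat.
by move=> g; rewrite mem_cat => /orP[/rM|/rM'].
Qed.

Lemma forest_groupN M u : forest_group M u -> forest_group M (- u).
Proof.
move: u; apply: forest_group_ind.
- by rewrite /= oppr0; exact: forest_group0.
- by move=> u v /= Mu Mv; rewrite opprD; exact: forest_groupD.
move=> [[[[b s] l] z] k] Mg /=.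
suff -> : - gen (b, s, l, z, k) = gen (b, s, l, - z, k).
  exact: forest_group_gen.
by rewrite /gen; case: b {Mg}; rewrite -scaleNr -mulNr rmorphN.
Qed.

Lemma forest_group_infinite M s l : M s l ->
  exists2 f : nat -> {poly rat}, injective f & forall n, forest_group M (f n).
Proof.
move=> Msl; exists (fun n => gen (true, s, l, n%:Z, 0%N)); last first.
  by move=> n; exact: forest_group_gen.
move=> m n /(congr1 (fun v : {poly rat} => v`_(pickle s))) /=.
by rewrite !coefZ coefXn eqxx !mulr1 => /intr_inj [].
Qed.

Lemma monom_coef s i : (monom s)`_i = (i == pickle s)%:R.
Proof. by rewrite coefXn. Qed.

(** Powers of the prime of [l] occur as denominators only in the multiples of e_s with [s] labelled
    [l]. The hypothesis also covers an index [i] that codes no node. *)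
Lemma forest_group_coef M (v : {poly rat}) l i : forest_group M v ->
  ~ (exists2 s, i = pickle s & M s l) -> local_int (prime_of (inl l)) v`_i.
Proof.
move=> + nM; move: v; have pl := prime_of_prime (inl l).
apply: forest_group_ind => /=.
- by rewrite coef0; exact: local_int0.
- by move=> u v; rewrite coefD; exact: local_intD.
move=> [[[[b s] l'] z] k]; rewrite /gen_valid /= => Msl.
case: b; rewrite coefZ ?coefB !monom_coef; last first.
  apply: local_intM; last by rewrite rpredB ?natr_int.
  by apply: local_int_div_prime => //; [exact: prime_of_prime|rewrite prime_of_eq].
have [is_|_] := eqVneq i (pickle s); last by rewrite mulr0; exact: local_int0.
rewrite mulr1; apply: local_int_div_prime => //; first exact: prime_of_prime.
rewrite prime_of_eq; apply/eqP => -[ll']; apply: nM.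
by exists s => //; rewrite -ll'.
Qed.

(** The functional adding the coefficient at [t] and those at its children. The level test keeps a
    root that is its own parent from counting as its own child. *)
Definition child_weight (t : N) (i : nat) : rat^o :=
  (i == pickle t)%:R +
  (if pickle_inv i is Some s then (lev s == (lev t).+1) && (par s == t)
   else false)%:R.

Lemma child_weight_pickle t s : child_weight t (pickle s) =
  (s == t)%:R + ((lev s == (lev t).+1) && (par s == t))%:R.
Proof.
by rewrite /child_weight pickleK_inv (inj_eq (pcan_inj (@pickleK N))).
Qed.

Hypothesis lev_par : forall s, lev (par s) = (lev s).-1.

(** The prime of level [lev t + 1] occurs as denominator only in multiples of e_s - e_(par s) with
    [s] on that level. There the functional vanishes: both vectors weigh 1 if [par s = t], and 0
    otherwise. *)
Lemma forest_group_child M (v : {poly rat}) t : forest_group M v ->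
  local_int (prime_of (inr (lev t).+1)) (linear_ext (child_weight t) v).
Proof.
move: v; set p := prime_of _; have pp : prime p by exact: prime_of_prime.
apply: forest_group_ind => /=.
- by rewrite linear0; exact: local_int0.
- by move=> u v; rewrite linearD; exact: local_intD.
move=> [[[[b s] l] z] k] _; rewrite /gen.
case: b; rewrite linearZ ?linearB /= !linear_extXn !child_weight_pickle.
  apply: local_intM; last by rewrite rpredD ?natr_int.
  by apply: local_int_div_prime => //; [exact: prime_of_prime|rewrite prime_of_eq].
have [ls|ls] := eqVneq (lev s) (lev t).+1; last first.
  apply: local_intM; last by rewrite rpredB ?rpredD ?natr_int.
  apply: local_int_div_prime => //; first exact: prime_of_prime.
  by rewrite prime_of_eq; apply: contra ls => /eqP[->].
have -> : (s == t) = false by apply: contra_eqF ls => /eqP ->; rewrite ltn_eqF.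
rewrite lev_par ls /= add0r ltn_eqF// addr0 subrr scaler0.
exact: local_int0.
Qed.

(** The value ['X^0] is a dummy: by [forest_group_support], vectors of the group have zero
    coefficients at indices that code no node. *)
Definition node_map (f : N -> N) (i : nat) : {poly rat} :=
  if pickle_inv i is Some s then monom (f s) else 'X^0.

Lemma linear_ext_node_map f s :
  linear_ext (node_map f) (monom s) = monom (f s).
Proof. by rewrite linear_extXn /node_map pickleK_inv. Qed.

Lemma forest_group_support M (v : {poly rat}) i : forest_group M v ->
  v`_i != 0 -> exists s, i = pickle s.
Proof.
move=> Mv /eqP vi; apply: contra_notP vi => nM; move: v Mv.
apply: forest_group_ind => /=.
- by rewrite coef0.
- by move=> u v; rewrite coefD => -> ->.
move=> [[[[b s] l'] z] k] _.
have Z s' : (monom s')`_i = 0.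
  by rewrite monom_coef; case: eqP => // is_; case: nM; exists s'.
by rewrite /gen; case: b; rewrite coefZ ?coefB !Z ?subr0 mulr0.
Qed.

Lemma linear_ext_node_map_coef f (v : {poly rat}) s :
  injective f -> (forall i, v`_i != 0 -> exists s, i = pickle s) ->
  (linear_ext (node_map f) v)`_(pickle (f s)) = v`_(pickle s).
Proof.
move=> f_inj vM; rewrite /linear_ext coef_sum.
have Z (i : nat) : (v`_i *: node_map f i)`_(pickle (f s)) =
    if i == pickle s then v`_i else 0.
  rewrite coefZ; have [->|/vM[s' ->]] := eqVneq v`_i 0.
    by rewrite mul0r; case: ifP.
  rewrite /node_map pickleK_inv monom_coef !(inj_eq (pcan_inj (@pickleK N))).
  by rewrite (inj_eq f_inj) eq_sym; case: eqP; rewrite (mulr1, mulr0).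
under eq_bigr do rewrite Z.
have [lt|ge] := ltnP (pickle s) (size v).
  rewrite (bigD1 (Ordinal lt))//= eqxx big1 ?addr0// => i.
  by rewrite -val_eqE /= => /negbTE ->.
rewrite nth_default// big1// => i _; case: eqP => // E.
by move: (ltn_ord i); rewrite E ltnNge ge.
Qed.

(** The linear extension of [f] sends generators to generators with the same label, multiplier and
    exponent. It is injective on the group because the coefficient at [s] reappears in the image at
    [f s]. *)
Lemma forest_group_map M M' (f : N -> N) : injective f ->
  (forall s, lev (f s) = lev s) -> (forall s, par (f s) = f (par s)) ->
  (forall s l, M s l -> M' (f s) l) ->
  exists h : {poly rat} -> {poly rat},
    [/\ forall v, forest_group M v -> forest_group M' (h v),
        forall u v, forest_group M u -> forest_group M v -> h u = h v -> u = v &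
        forall u v, forest_group M u -> forest_group M v -> h (u + v) = h u + h v].
Proof.
move=> f_inj f_lev f_par f_M; exists (linear_ext (node_map f)); split.
- apply: forest_group_ind => /=.
  + by rewrite linear0; exact: forest_group0.
  + by move=> u v; rewrite linearD; exact: forest_groupD.
  move=> [[[[b s] l] z] k] /= Mg.
  suff -> : linear_ext (node_map f) (gen (b, s, l, z, k)) = gen (b, f s, l, z, k).
    by apply: forest_group_gen; apply: f_M.
  rewrite /gen; case: b {Mg}; rewrite linearZ ?linearB /=.
    by rewrite linear_ext_node_map.
  by rewrite !linear_ext_node_map f_lev f_par scalerBr.
- move=> u v Mu Mv; move/eqP; rewrite -subr_eq0 -linearB /= => /eqP E.
  have Muv := forest_groupD Mu (forest_groupN Mv).
  apply/eqP; rewrite -subr_eq0; apply/eqP/polyP => i; rewrite coef0.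
  apply/eqP; apply: contrapT => /negP /[dup] + uvi.
  case/(forest_group_support Muv) => s is_.
  move: uvi; rewrite is_ -(linear_ext_node_map_coef s f_inj).
    by rewrite E coef0 eqxx.
  by move=> j; exact: (forest_group_support Muv).
- by move=> u v _ _; rewrite linearD.
Qed.

(** * Branches recovered from an embedding of forest groups *)

Section Branch.
Variables (M M' : N -> L -> Prop) (h : {poly rat} -> {poly rat}).
Hypothesis hM : forall v, forest_group M v -> forest_group M' (h v).
Hypothesis h_inj :
  forall u v, forest_group M u -> forest_group M v -> h u = h v -> u = v.
Hypothesis hD :
  forall u v, forest_group M u -> forest_group M v -> h (u + v) = h u + h v.

Let h0 : h 0 = 0.
Proof.
have := hD (forest_group0 M) (forest_group0 M); rewrite addr0 => /eqP.
by rewrite -subr_eq subrr eq_sym => /eqP.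
Qed.

Let forest_groupMn v n : forest_group M v -> forest_group M (v *+ n).
Proof.
move=> Mv; elim: n => [|n IH]; first by rewrite mulr0n; exact: forest_group0.
by rewrite mulrS; exact: forest_groupD.
Qed.

Let hMn v n : forest_group M v -> h (v *+ n) = h v *+ n.
Proof.
move=> Mv; elim: n => [|n IH]; first by rewrite !mulr0n h0.
by rewrite !mulrS hD ?IH//; exact: forest_groupMn.
Qed.

Let hB u v : forest_group M u -> forest_group M v -> h (u - v) = h u - h v.
Proof.
move=> Mu Mv; apply/eqP; rewrite eq_sym subr_eq -hD// ?subrK//.
exact: forest_groupD (forest_groupN _).
Qed.

(** Additive maps preserve divisibility, so [F (h v)] is divisible by every power of [p] within the
    integers localised at [p]. *)
Let h_divisible (F : {linear {poly rat} -> rat^o}) p v : prime p ->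
  (forall u, forest_group M' u -> local_int p (F u)) ->
  (forall k, exists2 u, forest_group M u & v = u *+ (p ^ k)) -> F (h v) = 0.
Proof.
move=> pp FM' vdiv; apply: (local_int_divisible pp) => k.
have [u Mu ->] := vdiv k; exists (F (h u)); first exact/FM'/hM.
by rewrite hMn// linearMn -natrX mulr_natr.
Qed.

Let gen_divisible b s l (v : {poly rat}) : M s l ->
  v = gen (b, s, l, 1, 0%N) -> let p := prime_of (if b then inl l else inr (lev s)) in
  forall k, exists2 u, forest_group M u & v = u *+ (p ^ k).
Proof.
move=> Msl -> p k; exists (gen (b, s, l, 1, k)).
  exact: forest_group_gen.
have pk : p%:R ^+ k != 0 :> rat.
  by rewrite expf_neq0// pnatr_eq0 -lt0n prime_gt0// prime_of_prime.
have E (w : {poly rat}) :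
    (1%:~R / p%:R ^+ 0) *: w = (1%:~R / p%:R ^+ k) *: w *+ (p ^ k).
  by rewrite expr0 invr1 -scaler_nat scalerA natrX mulrCA (mulfV pk).
by move: E; rewrite /gen /p; case: (b) => E; exact: E.
Qed.

Variables (xi : nat -> N) (lam : nat -> L).
Hypothesis xi_M : forall n, M (xi n) (lam n).
Hypothesis lev_xi : forall n, lev (xi n) = n.
Hypothesis par_xi : forall n, par (xi n.+1) = xi n.
(** Label primes constrain only the labels in the support of the image of [xi n]; this turns the
    label into the level [n]. *)
Hypothesis lev_lam : forall n s, M' s (lam n) -> lev s = n.

Let xi_group n : forest_group M (monom (xi n)).
Proof.
suff -> : monom (xi n) = gen (true, xi n, lam n, 1, 0%N).
  by apply: forest_group_gen; exact: xi_M.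
by rewrite /gen expr0 divr1 scale1r.
Qed.

Let vec n := h (monom (xi n)).

Let vec_neq0 : exists i, (vec 0%N)`_i != 0.
Proof.
apply: contrapT => H; have : monom (xi 0%N) = 0.
  apply: h_inj => //; first exact: forest_group0.
  rewrite h0; apply/polyP => i; rewrite coef0; apply/eqP.
  by apply: contrapT => /negP vi; apply: H; exists i.
move/(congr1 (fun v : {poly rat} => v`_(pickle (xi 0%N)))).
by rewrite monom_coef eqxx coef0 => /eqP; rewrite oner_eq0.
Qed.

(** [vec n] is divisible by all powers of the prime of [lam n], while its coefficients away from the
    nodes labelled [lam n] are local at that prime, hence zero. *)
Let vec_support n i : (vec n)`_i != 0 -> exists2 s, i = pickle s & M' s (lam n).
Proof.
move=> /eqP vi; apply: contra_notP vi => nM.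
have E : monom (xi n) = gen (true, xi n, lam n, 1, 0%N).
  by rewrite /gen expr0 divr1 scale1r.
have D := gen_divisible (xi_M n) E.
pose w (j : nat) : rat^o := (i == j)%:R.
have wE (v : {poly rat}) : linear_ext w v = v`_i.
  transitivity (linear_ext w (\poly_(j < size v) v`_j)); first by rewrite coefK.
  rewrite poly_def linear_sum /= -[in RHS](coefK v) poly_def coef_sum.
  by apply: eq_bigr => j _; rewrite linearZ /= linear_extXn coefZ coefXn.
rewrite -wE; apply: (h_divisible (F := linear_ext w)) D.
  exact: prime_of_prime.
by move=> u Mu; rewrite [X in local_int _ X]wE; exact: forest_group_coef Mu nM.
Qed.

(** [vec n.+1 - vec n] is divisible by all powers of the prime of level [n.+1], so both vectors have
    the same child weight at [t]. For [vec n] this is the coefficient at [t], for [vec n.+1] the sum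
    over the children of [t]. *)
Let vec_child n t : lev t = n -> (vec n)`_(pickle t) != 0 ->
  exists2 s, (vec n.+1)`_(pickle s) != 0 & par s = t.
Proof.
move=> lt vt.
have E : monom (xi n.+1) - monom (xi n) = gen (false, xi n.+1, lam n.+1, 1, 0%N).
  by rewrite /gen expr0 divr1 scale1r par_xi.
have D := gen_divisible (xi_M n.+1) E.
have : linear_ext (child_weight t) (h (monom (xi n.+1) - monom (xi n))) = 0.
  apply: (h_divisible (F := linear_ext (child_weight t))) D.
    exact: prime_of_prime.
  by move=> u; rewrite lev_xi -lt; exact: forest_group_child.
rewrite hB// linearB -/(vec n) -/(vec n.+1) => /eqP; rewrite subr_eq0 => /eqP VV.
have : linear_ext (child_weight t) (vec n) != 0.
  have -> : linear_ext (child_weight t) (vec n) = (vec n)`_(pickle t); last exact: vt.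
  have tn : (pickle t < size (vec n))%N.
    by rewrite ltnNge; apply: contra vt => /(nth_default 0) ->.
  rewrite /linear_ext (bigD1 (Ordinal tn))//= big1 ?addr0.
    rewrite child_weight_pickle eqxx ltn_eqF// addr0.
    by rewrite [_ *: _]mulr1.
  (* The support of [vec n] lies on level [n], so it contains no child of [t]. *)
  move=> i it; have [->|/vec_support[s is_ /lev_lam ls]] := eqVneq (vec n)`_i 0.
    by rewrite scale0r.
  rewrite is_ child_weight_pickle ls lt ltn_eqF// addr0.
  case: eqP => [st|_]; last by rewrite scaler0.
  by move: it; rewrite -val_eqE /= is_ st eqxx.
rewrite -VV => /linear_ext_neq0[i vi].
have [s is_ /lev_lam ls] := vec_support vi.
rewrite is_ in vi *; rewrite child_weight_pickle ls lt eqxx.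
have [st|_] := eqVneq s t; first by move: ls; rewrite st lt => /n_Sn.
rewrite add0r; have [pst _|_] := eqVneq (par s) t; first by exists s.
by rewrite andbF mulr0n eqxx.
Qed.

Lemma forest_group_branch : exists zeta : nat -> N,
  forall n, M' (zeta n) (lam n) /\ par (zeta n.+1) = zeta n.
Proof.
have [i vi] := vec_neq0; have [t0 it0 Mt0] := vec_support vi.
rewrite it0 in vi.
pose good n s := M' s (lam n) /\ (vec n)`_(pickle s) != 0.
(* Outside [good] the successor is arbitrary; totality lets ordinary choice do the work of dependent
   choice. *)
have step (a : nat * N) : exists b : nat * N,
    good a.1 a.2 -> [/\ b.1 = a.1.+1, good b.1 b.2 & par b.2 = a.2].
  case: (pselect (good a.1 a.2)) => [[Ma va]|na]; last by exists a.
  have [s vs pst] := vec_child (lev_lam Ma) va.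
  exists (a.1.+1, s) => _; split => //; split => //.
  have [s' ss' Ms'] := vec_support vs.
  by rewrite (pcan_inj (@pickleK N) ss').
have [F FE] := choice step.
pose z n := iter n F (0%N, t0).
have zg n : (z n).1 = n /\ good (z n).1 (z n).2.
  elim: n => [|n [IH1 IH2]]; first by [].
  by rewrite /z iterS -/(z n); have [b1 gb _] := FE _ IH2; rewrite b1 IH1 in gb *.
exists (fun n => (z n).2) => n; have [zn gz] := zg n; split.
  by case: gz; rewrite zn.
by have [] := FE _ gz.
Qed.

End Branch.
End ForestGroup.

(** * Infinite subgroups of a countable group as group structures on nat *)

Section Countable.
Context d (T : measurableType d).

Lemma measurable_ex (I : countType) (P : I -> T -> Prop) :
  (forall i, measurable [set x | P i x]) -> measurable [set x | exists i, P i x].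
Proof.
move=> mP; have -> : [set x | exists i, P i x] =
    \bigcup_n [set x | if pickle_inv n is Some i then P i x else False].
  apply/seteqP; split => x /=.
    by move=> [i Pix]; exists (pickle i) => //=; rewrite pickleK_inv.
  by move=> [n _] /=; case: pickle_inv => // i Pix; exists i.
apply: bigcup_measurable => n _; case: pickle_inv => [i|]; [exact: mP|exact: measurable0].
Qed.

Lemma measurable_not (P : T -> Prop) :
  measurable [set x | P x] -> measurable [set x | ~ P x].
Proof. exact: measurableC. Qed.

Lemma measurable_and (P Q : T -> Prop) : measurable [set x | P x] ->
  measurable [set x | Q x] -> measurable [set x | P x /\ Q x].
Proof. exact: measurableI. Qed.

Lemma measurable_all (I : countType) (P : I -> T -> Prop) :
  (forall i, measurable [set x | P i x]) -> measurable [set x | forall i, P i x].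
Proof.
move=> mP; have -> : [set x | forall i, P i x] = [set x | ~ exists i, ~ P i x].
  apply/seteqP; split => x /= H; first by case.
  by move=> i; apply: contrapT => nP; apply: H; exists i.
apply: measurable_not; apply: measurable_ex => i; exact: measurable_not.
Qed.

Lemma measurable_const (Q : Prop) : measurable [set x : T | Q].
Proof.
have [q|nq] := pselect Q.
  by have -> : [set x : T | Q] = setT by apply/seteqP; split.
by have -> : [set x : T | Q] = set0 by apply/seteqP; split.
Qed.

Lemma measurable_imply (P Q : T -> Prop) : measurable [set x | P x] ->
  measurable [set x | Q x] -> measurable [set x | P x -> Q x].
Proof.
move=> mP mQ; have -> : [set x | P x -> Q x] = [set x | ~ (P x /\ ~ Q x)].
  apply/seteqP; split => x /=; first by move=> PQ [/PQ].
  by move=> H Px; apply: contrapT => nQ; apply: H.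
by apply: measurable_not; apply: measurable_and => //; exact: measurable_not.
Qed.

End Countable.

(** * The increasing enumeration of an infinite subgroup *)

Section Enumeration.
Variable V : countZmodType.
Implicit Types (A : set V) (u v : V) (i j m n : nat).

Definition code_mem A m : bool := `[< exists2 v, A v & pickle v = m >].

(** The position of [v] in [A], ordered by codes; for infinite [A], [elt] is the inverse
    bijection. *)
Definition rank A v : nat := count (code_mem A) (iota 0 (pickle v)).

Definition elt A i : V := xget 0 [set v | A v /\ rank A v = i].

Lemma code_memP A v : reflect (A v) (code_mem A (pickle v)).
Proof.
apply: (iffP (asboolP _)) => [[w Aw /(pcan_inj (@pickleK V)) <-]//|Av].
by exists v.
Qed.

Lemma count_iotaS A m :
  count (code_mem A) (iota 0 m.+1) = (count (code_mem A) (iota 0 m) + code_mem A m)%N.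
Proof. by rewrite -addn1 iotaD count_cat /= addn0. Qed.

Let rank_lt A u v : A u -> A v -> (pickle u < pickle v)%N -> (rank A u < rank A v)%N.
Proof.
move=> Au Av uv; rewrite /rank -(subnKC uv) iotaD count_cat count_iotaS.
by have /code_memP -> := Au; rewrite addn1 leq_addr.
Qed.

Lemma rank_inj A u v : A u -> A v -> rank A u = rank A v -> u = v.
Proof.
move=> Au Av ruv; apply: (pcan_inj (@pickleK V)).
case: (ltngtP (pickle u) (pickle v)) => // uv.
  by have := rank_lt Au Av uv; rewrite ruv ltnn.
by have := rank_lt Av Au uv; rewrite ruv ltnn.
Qed.

Section Subgroup.
Variable A : set V.
Hypothesis A_inf : exists2 f : nat -> V, injective f & forall n, A (f n).

Lemma rank_surj i : exists v, A v /\ rank A v = i.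
Proof.
have [f f_inj Af] := A_inf.
(* The codes of [f 0], ..., [f i] are distinct codes of elements of [A]. *)
have unb : exists m, (i < count (code_mem A) (iota 0 m))%N.
  pose s := [seq pickle (f j) | j <- iota 0 i.+1].
  exists (\max_(k <- s) k).+1; rewrite -size_filter.
  have -> : i.+1 = size s by rewrite size_map size_iota.
  apply: uniq_leq_size.
    by rewrite map_inj_uniq ?iota_uniq// => a b /(pcan_inj (@pickleK V))/f_inj.
  move=> k ks; rewrite mem_filter mem_iota /= add0n ltnS.
  rewrite (leq_bigmax_seq k)// andbT.
  by have /mapP[j _ ->] := ks; apply/code_memP.
(* If [m.+1] is the least bound with more than [i] codes below it, then [m] codes the element of
   rank [i]. *)
case: (ex_minnP unb) => -[//|m] im mmin.
have mi : (count (code_mem A) (iota 0 m) <= i)%N.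
  by rewrite leqNgt; apply/negP => /mmin; rewrite ltnn.
move: im; rewrite count_iotaS; case: (boolP (code_mem A m)) => [|_]; last first.
  by rewrite addn0 ltnNge mi.
move=> /asboolP[v Av vm]; rewrite addn1 ltnS => im; exists v; split => //.
by apply/eqP; rewrite /rank vm eqn_leq mi.
Qed.

Lemma eltP i : A (elt A i) /\ rank A (elt A i) = i.
Proof. exact: (@xgetPex V 0 [set v | A v /\ rank A v = i] (rank_surj i)). Qed.

Lemma rankK v : A v -> elt A (rank A v) = v.
Proof. by move=> Av; have [? ?] := eltP (rank A v); apply: (@rank_inj A). Qed.

Lemma eltE i v : elt A i = v <-> A v /\ rank A v = i.
Proof.
split=> [<-|[Av <-]]; [exact: eltP|exact: rankK].
Qed.

Hypothesis A0 : A 0.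
Hypothesis AD : forall u v, A u -> A v -> A (u + v).
Hypothesis AN : forall u, A u -> A (- u).

Definition subgroup_mul i j : nat := rank A (elt A i + elt A j).

Lemma elt_mul i j : elt A (subgroup_mul i j) = elt A i + elt A j.
Proof. by rewrite rankK//; apply: AD; exact: (eltP _).1. Qed.

Lemma subgroup_mul_law : group_law subgroup_mul.
Proof.
have inj i j : elt A i = elt A j -> i = j.
  by move=> e; rewrite -(eltP i).2 e (eltP j).2.
have e0 : elt A (rank A 0) = 0 by rewrite rankK.
split; first by move=> i j k; apply: inj; rewrite !elt_mul addrA.
exists (rank A 0); split.
- by move=> i; apply: inj; rewrite elt_mul e0 add0r.
- by move=> i; apply: inj; rewrite elt_mul e0 addr0.
- move=> i; have Ai := AN (eltP i).1.
  by exists (rank A (- elt A i)); split; apply: inj;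
    rewrite elt_mul e0 rankK// (addNr, addrN).
Qed.

End Subgroup.
End Enumeration.

(** * Measurable dependence of the enumeration on the subgroup *)

Section MeasurableEnumeration.
Context d (T : measurableType d) (V : countZmodType) (A : T -> set V).
Hypothesis mA : forall v, measurable [set x | A x v].

Lemma measurable_rank v i : measurable [set x | rank (A x) v = i].
Proof.
rewrite /rank; elim: (pickle v) i => [|m IH] i.
  exact: (measurable_const T (0%N = i)).
have mm : measurable [set x | code_mem (A x) m].
  rewrite (_ : mkset _ = [set x | exists w, A x w /\ pickle w = m]).
    by apply: measurable_ex => w; apply: measurable_and => //; exact: measurable_const.
  apply/seteqP; split => x /=; first by move=> /asboolP[w Aw wm]; exists w.
  by move=> [w [Aw wm]]; apply/asboolP; exists w.
(* Naming the last bit and the previous count splits the set into countably many pieces within reach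
   of the induction hypothesis. *)
rewrite (_ : mkset _ = [set x | exists b : bool * nat,
   ((code_mem (A x) m <-> b.1) /\ count (code_mem (A x)) (iota 0 m) = b.2) /\
    (b.2 + b.1)%N = i]).
  apply: measurable_ex => -[b k]; apply: measurable_and; last exact: measurable_const.
  apply: measurable_and; last exact: IH.
  case: b.
    rewrite (_ : mkset _ = [set x | code_mem (A x) m])//.
    by apply/seteqP; split => x /= => [[_ ->]|->].
  rewrite (_ : mkset _ = [set x | ~ code_mem (A x) m]); first exact: measurable_not.
  by apply/seteqP; split => x /=; case: code_mem => // -[] // /(_ isT).
apply/seteqP; split => x; rewrite /mkset count_iotaS.
  by move=> <-; exists (code_mem (A x) m, count (code_mem (A x)) (iota 0 m)).
by move=> [[b k] /= [[bE ->] <-]]; congr (_ + nat_of_bool _)%N; apply/idP/idP; apply bE.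
Qed.

Hypothesis A_inf : forall x, exists2 f : nat -> V, injective f & forall n, A x (f n).

Lemma measurable_elt v i : measurable [set x | elt (A x) i = v].
Proof.
rewrite (_ : mkset _ = [set x | A x v /\ rank (A x) v = i]).
  by apply: measurable_and => //; exact: measurable_rank.
by apply/seteqP; split => x /eltE; apply.
Qed.

Lemma measurable_subgroup_mul i j k :
  measurable [set x | subgroup_mul (A x) i j = k].
Proof.
rewrite (_ : mkset _ = [set x | exists w : V * V,
   (elt (A x) i = w.1 /\ elt (A x) j = w.2) /\ rank (A x) (w.1 + w.2) = k]).
  apply: measurable_ex => w; apply: measurable_and; last exact: measurable_rank.
  by apply: measurable_and; exact: measurable_elt.
apply/seteqP; split => x /=; first by exists (elt (A x) i, elt (A x) j).
by move=> [w [[w1 w2] <-]]; rewrite /subgroup_mul w1 w2.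
Qed.

End MeasurableEnumeration.

(** * Souslin representations of analytic relations *)

Definition agree (T : Type) (n : nat) (a b : nat -> T) : Prop :=
  forall i, (i < n)%N -> a i = b i.

(* The relation is a closed subset of [T^N * U^N], [T] and [U] being discrete. *)
Definition closed_rel (T U : Type) (K : (nat -> T) -> (nat -> U) -> Prop) : Prop :=
  forall w b,
    (forall n, exists w' b', [/\ agree n w w', agree n b b' & K w' b']) -> K w b.

(** An analytic subset of [T^N], as the projection of a closed set along the Baire space. *)
Definition souslin (T : Type) (A : set (nat -> T)) : Prop :=
  exists K : (nat -> T) -> (nat -> nat) -> Prop,
    closed_rel K /\ forall w, A w <-> exists b, K w b.

Section Souslin.
Variable T : Type.
Implicit Types (A : set (nat -> T)) (F : nat -> set (nat -> T)).

Lemma souslin_coord k (Q : set T) : souslin [set w | Q (w k)].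
Proof.
exists (fun w _ => Q (w k)); split.
  by move=> w b /(_ k.+1)[w' [b' [ww' _]]]; rewrite ww'.
by move=> w; split=> [Qw|[]//]; exists id.
Qed.

Lemma souslin_bigcup F : (forall m, souslin (F m)) -> souslin (\bigcup_m F m).
Proof.
move=> sF; have [K KF] := choice sF.
(* The first value of the witness names the set [F m]; the remaining values are a witness for it. *)
exists (fun w b => K (b 0%N) w (fun i => b i.+1)); split.
  move=> w b H; apply: (KF _).1 => n.
  have [w' [b' [ww' bb' K']]] := H n.+1.
  exists w', (fun i => b' i.+1); split; last by rewrite bb'.
    by move=> i /ltnW; exact: ww'.
  by move=> i; exact: (bb' i.+1).
move=> w; split.
  move=> [m _ /((KF m).2 w).1[b Kb]].
  by exists (fun i => if i is j.+1 then b j else m).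
by move=> [b Kb]; exists (b 0%N) => //; apply/(KF _).2; exists (fun i => b i.+1).
Qed.

Lemma souslin_bigcap F : (forall m, souslin (F m)) -> souslin (\bigcap_m F m).
Proof.
move=> sF; have [K KF] := choice sF.
(* One sequence holds witnesses for all [F m], the [m]-th at the positions [pickle (m, i)]. *)
exists (fun w b => forall m, K m w (fun i => b (pickle (m, i)))); split.
  move=> w b H m; apply: (KF _).1 => n.
  pose n' := maxn n (\max_(i < n) (pickle (m, nat_of_ord i)).+1).
  have [w' [b' [ww' bb' K']]] := H n'.
  exists w', (fun i => b' (pickle (m, i))); split => // i ilt.
    by apply: ww'; rewrite (leq_trans ilt) ?leq_maxl.
  apply: bb'; apply: leq_trans (leq_maxr _ _).
  exact: (@leq_bigmax _ (fun i : 'I_n => (pickle (m, nat_of_ord i)).+1) (Ordinal ilt)).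
move=> w; split.
  move=> Fw; have /choice[b Kb] m : exists b, K m w b.
    by apply/(KF m).2; exact: Fw.
  exists (fun j => if unpickle j is Some mi then b mi.1 mi.2 else 0%N) => m.
  rewrite (_ : (fun i => _) = b m)//; apply/funext => i.
  by rewrite pickleK.
by move=> [b Kb] m _; apply/(KF m).2; eexists; exact: Kb.
Qed.

Lemma souslin_setI A B : souslin A -> souslin B -> souslin (A `&` B).
Proof.
move=> sA sB; rewrite (_ : A `&` B = \bigcap_m if m is 0%N then A else B).
  by apply: souslin_bigcap => -[].
apply/seteqP; split => w; first by move=> [Aw Bw] [|m].
by move=> H; split; [exact: (H 0%N)|exact: (H 1%N)].
Qed.

End Souslin.

Lemma souslin_comp (T U : Type) (h : U -> T) (A : set (nat -> T)) :
  souslin A -> souslin [set w : nat -> U | A (h \o w)].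
Proof.
move=> [K [Kc KA]]; exists (fun w b => K (h \o w) b).
split=> [w b H|w]; last exact: KA.
apply: Kc => n; have [w' [b' [ww' bb' K']]] := H n.
by exists (h \o w'), b'; split => // i ilt; rewrite /= ww'.
Qed.

(** With [smallest_sub], this reduces a claim on preimages under [h] to generators. *)
Lemma sigma_algebra_preimage_system (T T' : Type) (h : T -> T')
    (C : set (set T)) :
  sigma_algebra setT C -> sigma_algebra setT [set A | C (h @^-1` A)].
Proof.
move=> [C0 CC CU]; split => /=.
- by rewrite preimage_set0.
- by move=> A /CC; rewrite !setTD -preimage_setC.
- by move=> F CF; rewrite preimage_bigcup; exact: CU.
Qed.

Lemma measurable_prod_sub d1 d2 (T1 : measurableType d1) (T2 : measurableType d2)
    (C : set (set (T1 * T2))) : sigma_algebra setT C ->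
  (forall A, measurable A -> C (fst @^-1` A)) ->
  (forall A, measurable A -> C (snd @^-1` A)) ->
  measurable `<=` C.
Proof.
move=> sC C1 C2; apply: smallest_sub => //.
by move=> _ [[A mA <-]|[A mA <-]]; rewrite setTI; [exact: C1|exact: C2].
Qed.

Definition cylinders (X : Type) (phi : X -> nat -> nat) : set (set X) :=
  [set A | exists k j, A = [set x | phi x k = j]].

Section BorelCode.
Context d (X : measurableType d).

(** [phi] identifies [X] with a Souslin subset of the Baire space; the third clause says that its
    coordinates generate all measurable sets. *)
Definition borel_code (phi : X -> nat -> nat) : Prop :=
  [/\ injective phi,
      forall k j, measurable [set x | phi x k = j],
      measurable `<=` <<s cylinders phi >> &
      souslin (range phi)].

End BorelCode.

(** * Coding a Polish space in the Baire space *)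

Section PolishCode.
Variables (R : realType) (Y : metricType R).
Local Notation dist := (@mdist R Y).
Let eps (k : nat) : R := k.+1%:R^-1.

Let eps_gt0 k : 0 < eps k.
Proof. by rewrite invr_gt0. Qed.

Let eps_lt (e : R) : 0 < e -> exists N, forall m, (N <= m)%N -> eps m < e.
Proof.
move=> e0; have [N _ HN] := near_infty_natSinv_lt (PosNum e0).
by exists N => m Nm; exact: HN.
Qed.

Let ball_open (y : Y) e : open [set z | dist y z < e].
Proof.
rewrite openE => z /= yz; apply/nbhs_ballP; exists (e - dist y z) => /=.
  by rewrite subr_gt0.
move=> t; rewrite ballEmdist /= ltrBrDl; apply: le_lt_trans.
exact: metric_triangle.
Qed.

Lemma polish_dense_sequence (y0 : Y) : polish Y ->
  exists s : nat -> Y, forall y e, 0 < e -> exists n, dist y (s n) < e.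
Proof.
move=> [[D /countable_injP[g g_inj] Ddense] _].
exists (fun n => xget y0 [set y | D y /\ g y = n]) => y e e0.
have [z [yz Dz]] : [set z | dist y z < e] `&` D !=set0.
  by apply: Ddense; [exists y; rewrite /= mdistxx|exact: ball_open].
exists (g z); set t := xget _ _.
have [Dt gt] : D t /\ g t = g z.
  by apply: (@xgetPex Y y0 [set t | D t /\ g t = g z]); exists z.
by rewrite (g_inj t z)// inE.
Qed.

Section Code.
Variable s : nat -> Y.
Hypothesis s_dense : forall y e, 0 < e -> exists n, dist y (s n) < e.
Hypothesis Ycomplete :
  forall u : nat -> Y, cauchy (u @ \oo) -> exists l : Y, u @ \oo --> l.

(** The least index of a point of the dense sequence within [1/(k+1)] of [y]. Minimality makes this
    a function of [y], Borel but in general not continuous. *)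
Definition polish_code (y : Y) (k : nat) : nat := ex_minn (s_dense y (eps_gt0 k)).

Lemma polish_codeE y k j : polish_code y k = j <->
  dist y (s j) < eps k /\ forall i, (i < j)%N -> eps k <= dist y (s i).
Proof.
rewrite /polish_code; case: ex_minnP => m ym mmin; split.
  move=> <-; split => // i im; rewrite leNgt; apply/negP => /mmin.
  by rewrite leqNgt im.
move=> [yj jmin]; apply/eqP; rewrite eqn_leq mmin//= leqNgt.
by apply/negP => /jmin; rewrite leNgt ym.
Qed.

Let polish_code_lt y k : dist y (s (polish_code y k)) < eps k.
Proof. by have [] := (polish_codeE y k _).1 erefl. Qed.

Let dist_le_eps (a b : Y) : (forall e, 0 < e -> dist a b < e) -> a = b.
Proof.
move=> H; apply/eqP; apply: contrapT => /negP; rewrite -mdist_gt0 => /H.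
by rewrite ltxx.
Qed.

Lemma polish_code_inj : injective polish_code.
Proof.
move=> y z yz; apply: dist_le_eps => e e0.
have [|N /(_ N (leqnn N)) Ne] := eps_lt (e := e / 2); first by rewrite divr_gt0.
have := polish_code_lt y N; have := polish_code_lt z N; rewrite -yz.
have := metric_triangle y (s (polish_code y N)) z.
rewrite (metric_sym z); lra.
Qed.

Lemma polish_code_measurable d (X : measurableType d) (f : X -> Y) k j :
  (forall U, open U -> measurable (f @^-1` U)) ->
  measurable [set x | polish_code (f x) k = j].
Proof.
move=> mf; have mB i : measurable [set x | dist (f x) (s i) < eps k].
  rewrite (_ : mkset _ = f @^-1` [set y | dist (s i) y < eps k]).
    exact/mf/ball_open.
  by apply/seteqP; split => y /=; rewrite metric_sym.
rewrite (_ : mkset _ = [set x | dist (f x) (s j) < eps k /\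
    forall i, (i < j)%N -> ~ dist (f x) (s i) < eps k]).
  apply: measurable_and => //; apply: measurable_all => i.
  apply: measurable_imply; first exact: measurable_const.
  exact: measurable_not.
apply/seteqP; split => x /=.
  by move=> /polish_codeE[yj jmin]; split => // i /jmin; rewrite leNgt => /negP.
move=> [yj jmin]; apply/polish_codeE; split => // i /jmin; rewrite leNgt.
by move/negP.
Qed.

(** Balls of radius [eps k] around points of the dense sequence separate [y] from the complement of
    [U], so [U] is a countable union of cylinders. *)
Lemma open_polish_code (U : set Y) : open U ->
  U = [set y | exists kj : nat * nat, (forall z, dist z (s kj.2) < eps kj.1 -> U z) /\
         polish_code y kj.1 = kj.2].
Proof.
move=> oU; apply/seteqP; split => y /=; last first.
  by move=> [[k j] /= [H yj]]; apply: H; rewrite -yj.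
move=> Uy; have /nbhs_ballP[e /= e0 eU] : nbhs y U by move: oU; rewrite openE; exact.
have [|N /(_ N (leqnn N)) Ne] := eps_lt (e := e / 2); first by rewrite divr_gt0.
exists (N, polish_code y N); split => //= z zj; apply: eU; rewrite ballEmdist /=.
have := metric_triangle y (s (polish_code y N)) z.
have := polish_code_lt y N; rewrite metric_sym in zj; lra.
Qed.

Lemma polish_code_souslin : souslin (range polish_code).
Proof.
(* Closed conditions on [a]. The first makes [s \o a] converge to some [y] within [eps k] of
   [s (a k)]; the second makes this bound strict, [t] witnessing the open condition; the third gives
   minimality of [a k]. *)
pose K (a t : nat -> nat) :=
  [/\ forall k l, dist (s (a k)) (s (a l)) <= eps k + eps l,
      forall k, dist (s (a (t k))) (s (a k)) + eps (t k) < eps k &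
      forall k j m, (j < a k)%N -> eps k <= dist (s (a m)) (s j) + eps m].
exists K; split.
  move=> a t H; split.
  - move=> k l; have [a' [t' [aa' _ [+ _ _]]]] := H (maxn k l).+1.
    by move/(_ k l); rewrite !aa'// ltnS ?leq_maxl ?leq_maxr.
  - move=> k; have [a' [t' [aa' tt' [_ + _]]]] := H (maxn k (t k)).+1.
    by move/(_ k); rewrite -tt' ?ltnS ?leq_maxl// !aa'// ltnS ?leq_maxl ?leq_maxr.
  - move=> k j m jk; have [a' [t' [aa' _ [_ _ +]]]] := H (maxn k m).+1.
    by move/(_ k j m); rewrite -!aa' ?ltnS ?leq_maxl ?leq_maxr//; apply.
move=> a; split.
  move=> [y _ <-]; set c := polish_code y.
  have yc := polish_code_lt y.
  have tri m z : dist (s (c m)) z <= eps m + dist y z.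
    have := metric_triangle (s (c m)) y z; rewrite (metric_sym _ y).
    by have := yc m; rewrite -/c; lra.
  have /choice[t Ht] k : exists m, dist (s (c m)) (s (c k)) + eps m < eps k.
    (* Half of the slack in the strict bound, because [eps m] enters twice. *)
    have [|N /(_ N (leqnn N)) Ne] := eps_lt (e := (eps k - dist y (s (c k))) / 2).
      by rewrite divr_gt0// subr_gt0 yc.
    by exists N; have := tri N (s (c k)); lra.
  exists t; split => //.
    by move=> k l; have := tri k (s (c l)); have := yc l; rewrite -/c; lra.
  move=> k j m jk; have /polish_codeE[_ /(_ j jk)] : polish_code y k = c k by [].
  have := metric_triangle y (s (c m)) (s j); have := yc m; rewrite -/c; lra.
move=> [t [K1 K2 K3]].
have [|y yl] := Ycomplete (u := s \o a).
  apply: cauchy_exP => e e0.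
  have [|N HN] := eps_lt (e := e / 2); first by rewrite divr_gt0.
  exists (s (a N)); exists N => // m /= Nm; rewrite ballEmdist /=.
  by have := K1 N m; have := HN N (leqnn N); have := HN m Nm; lra.
have ym e : 0 < e -> exists m, eps m < e /\ dist y (s (a m)) < e.
  move=> e0; have [N HN] := eps_lt e0.
  have /cvg_ballP/(_ e e0)[N' _ HN'] := yl.
  exists (maxn N N'); split; first by apply: HN; rewrite leq_maxl.
  by have := HN' (maxn N N') (leq_maxr _ _); rewrite /= ballEmdist.
have yk k : dist y (s (a k)) <= eps k.
  apply/ler_addgt0Pl => e e0.
  have [|m [em ym']] := ym (e / 2); first by rewrite divr_gt0.
  have := metric_triangle y (s (a m)) (s (a k)); have := K1 m k; lra.
exists y => //; apply/funext => k; apply/polish_codeE; split.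
  have := metric_triangle y (s (a (t k))) (s (a k)); have := K2 k.
  by have := yk (t k); lra.
move=> i ik; apply/ler_addgt0Pl => e e0.
have [|m [em ym']] := ym (e / 2); first by rewrite divr_gt0.
have := metric_triangle (s (a m)) y (s i); rewrite (metric_sym _ y).
by have := K3 k i m ik; lra.
Qed.

End Code.
End PolishCode.

Lemma standard_borel_code (R : realType) d (X : measurableType d) :
  standard_borel R X -> exists phi : X -> nat -> nat, borel_code phi.
Proof.
move=> [Y [f [Yp [g fK gK] fE]]].
have [s s_dense] := polish_dense_sequence (f point) Yp.
exists (polish_code s_dense \o f); split.
- exact: inj_comp (@polish_code_inj _ _ _ s_dense) (can_inj fK).
- move=> k j; apply: polish_code_measurable => U oU; apply/fE.
  exact: sub_sigma_algebra.
- move=> A mA; have -> : A = f @^-1` (g @^-1` A).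
    by apply/seteqP; split => x /=; rewrite fK.
  have : <<s @open Y >> (g @^-1` A).
    by apply/fE; rewrite -comp_preimage (_ : _ \o _ = id) ?preimage_id//; apply/funext.
  move: (g @^-1` A); apply: smallest_sub.
    apply: sigma_algebra_preimage_system; exact: smallest_sigma_algebra.
  move=> U /(open_polish_code s_dense) -> /=.
  apply: (@measurable_ex _ (g_sigma_algebraType (cylinders (polish_code s_dense \o f)))).
  move=> [k j]; apply: (@measurable_and _ (g_sigma_algebraType _)).
    exact: (@measurable_const _ (g_sigma_algebraType _)).
  by apply: sub_sigma_algebra; exists k, j.
- rewrite (_ : range _ = range (polish_code s_dense)).
    exact: polish_code_souslin Yp.2.
  apply/seteqP; split => [_ [x _ <-]|_ [y _ <-]]; first by exists (f x).
  by exists (g y) => //=; rewrite gK.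
Qed.

(** * Codes of Borel sets are Souslin *)

Section SouslinImage.
Context d (X : measurableType d) d' (Z : measurableType d').
Variables (phi : X -> nat -> nat) (psi : Z -> nat -> nat).
Hypothesis phi_code : borel_code phi.
Hypothesis psi_code : borel_code psi.

Let code (p : X * X * Z) (i : nat) : nat * nat * nat :=
  (phi p.1.1 i, phi p.1.2 i, psi p.2 i).

Let code_inj : injective code.
Proof.
have [phi_inj _ _ _] := phi_code; have [psi_inj _ _ _] := psi_code.
move=> [[x y] z] [[x' y'] z'] /(congr1 (fun h => fun i => h i)) E.
by congr ((_, _), _); [apply: phi_inj|apply: phi_inj|apply: psi_inj];
  apply/funext => i; move/(congr1 (@^~ i)): E => -[].
Qed.

Let souslin_range : souslin (range code).
Proof.
have [_ _ _ s1] := phi_code; have [_ _ _ s2] := psi_code.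
rewrite (_ : range code =
    [set w : nat -> nat * nat * nat | range phi ((fun t => t.1.1) \o w)] `&`
    ([set w : nat -> nat * nat * nat | range phi ((fun t => t.1.2) \o w)] `&`
     [set w : nat -> nat * nat * nat | range psi (snd \o w)])).
  by do ?apply: souslin_setI; apply: souslin_comp.
apply/seteqP; split => w.
  by move=> [[[x y] z] _ <-]; split; [exists x|split; [exists y|exists z]].
move=> [[x _ xE] [[y _ yE] [z _ zE]]]; exists ((x, y), z) => //.
apply/funext => i; rewrite /code /=.
move/(congr1 (@^~ i)): xE => ->; move/(congr1 (@^~ i)): yE => ->.
by move/(congr1 (@^~ i)): zE => -> /=; case: (w i) => -[].
Qed.

Let souslin_cylinder k (Q : set (nat * nat * nat)) :
  souslin (code @` [set p | Q (code p k)]).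
Proof.
rewrite (_ : _ @` _ = range code `&` [set w | Q (w k)]).
  by apply: souslin_setI => //; exact: souslin_coord.
apply/seteqP; split => w; first by move=> [p Qp <-]; split => //; exists p.
by move=> [[p _ <-] Qp]; exists p.
Qed.

(** The sets whose image and whose complement's image are both Souslin form a sigma-algebra
    containing the cylinders. Injectivity of [code] makes images commute with countable
    intersections. *)
Lemma souslin_image (B : set (X * X * Z)) : measurable B -> souslin (code @` B).
Proof.
pose C := [set B | souslin (code @` B) /\ souslin (code @` (~` B))].
suff sub : measurable `<=` C by move=> /sub[].
have cyl k (Q : set (nat * nat * nat)) : C [set p | Q (code p k)].
  split; first exact: souslin_cylinder.
  exact: (souslin_cylinder k (~` Q)).
have sC : sigma_algebra setT C.
  split.
  - by have := cyl 0%N set0.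
  - by move=> A [sA sA']; rewrite setTD; split => //; rewrite setCK.
  move=> F CF; split.
    by rewrite image_bigcup; exact: souslin_bigcup (fun m => (CF m).1).
  rewrite setC_bigcup (_ : _ @` _ = \bigcap_m (code @` (~` F m))).
    exact: souslin_bigcap (fun m => (CF m).2).
  apply/seteqP; split => w; first by move=> [p Fp <-] m _; exists p => //; exact: Fp.
  move=> H; have [p _ pw] := H 0%N I; exists p => // m _.
  by have [q Fq] := H m I; rewrite -pw => /code_inj <-.
have [_ _ sub1 _] := phi_code; have [_ _ sub2 _] := psi_code.
have prodC (h : X * X * Z -> X) (i : nat * nat * nat -> nat) :
    (forall p k, phi (h p) k = i (code p k)) ->
    forall A, measurable A -> C (h @^-1` A).
  move=> hi A /sub1; move: A; apply: smallest_sub.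
    exact: sigma_algebra_preimage_system.
  move=> _ [k [j ->]] /=.
  rewrite (_ : _ @^-1` _ = [set p | [set t | i t = j] (code p k)]); first exact: cyl.
  by apply/seteqP; split => p /=; rewrite hi.
apply: measurable_prod_sub => //.
  apply: measurable_prod_sub; first exact: sigma_algebra_preimage_system.
    exact: (prodC (fun p => p.1.1) (fun t => t.1.1)).
  exact: (prodC (fun p => p.1.2) (fun t => t.1.2)).
move=> A /sub2; move: A; apply: smallest_sub.
  exact: sigma_algebra_preimage_system.
move=> _ [k [j ->]]; exact: (cyl k [set t | t.2 = j]).
Qed.

End SouslinImage.

(** [g] bundles the code of [x] with the code of a point [z] such that [B ((x, y), z)] and with a
    Souslin witness for the triple. *)
Lemma analytic_quasi_order_code (R : realType) d (X : measurableType d)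
    (P : X -> X -> Prop) : analytic_quasi_order R P ->
  exists (phi : X -> nat -> nat)
    (K : (nat -> nat * (nat * nat)) -> (nat -> nat) -> Prop),
  [/\ injective phi, forall k j, measurable [set x | phi x k = j],
      closed_rel K,
      forall x y, P x y -> exists2 g, fst \o g = phi x & K g (phi y) &
      forall g b, K g b -> exists x y, [/\ P x y, fst \o g = phi x & b = phi y]].
Proof.
move=> [/standard_borel_code[phi phi_code] _ _].
move=> [d' [Z [/standard_borel_code[psi psi_code]]]].
move=> [B /(souslin_image phi_code psi_code)[K [Kc KB]] PB].
have PE x y : P x y <-> exists z, B ((x, y), z).
  have -> : P x y = [set p | P p.1 p.2] (x, y) by [].
  rewrite PB; split; first by move=> [[[x' y'] z] Bz /= [<- <-]]; exists z.
  by move=> [z Bz]; exists ((x, y), z).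
have [phi_inj phi_m _ _] := phi_code.
exists phi, (fun g b => K (fun i => ((g i).1, b i, (g i).2.1)) (fun i => (g i).2.2)).
split => //.
- move=> g b H; apply: Kc => n; have [g' [b' [gg' bb' K']]] := H n.
  exists (fun i => ((g' i).1, b' i, (g' i).2.1)), (fun i => (g' i).2.2).
  by split => // i ilt; rewrite gg'// bb'.
- move=> x y /PE[z Bz].
  have [|t Kt] := (KB (fun i => (phi x i, phi y i, psi z i))).1.
    by exists ((x, y), z).
  by exists (fun i => (phi x i, (psi z i, t i))).
- move=> g b Kgb.
  have [|[[x y] z] Bz E] := (KB (fun i => ((g i).1, b i, (g i).2.1))).2.
    by eexists; exact: Kgb.
  exists x, y; split; first by apply/PE; exists z.
    by apply/funext => i; move/(congr1 (@^~ i)): E => -[].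
  by apply/funext => i; move/(congr1 (@^~ i)): E => -[].
Qed.

(** * Standard Borel spaces from closed codes *)

(* The other arguments determine the metric on this copy of [X]. *)
Definition code_metric (R : realType) (X : pointedType) (c : X -> nat -> nat)
  of injective c : Type := X.

(** * The metric induced by an injective code *)

Section CodeMetric.
Variables (R : realType) (X : pointedType) (c : X -> nat -> nat).
Hypothesis c_inj : injective c.

Let eps (k : nat) : R := k.+1%:R^-1.

Let eps_gt0 k : 0 < eps k. Proof. by rewrite invr_gt0. Qed.

Let eps_ler m n : (eps m <= eps n) = (n <= m)%N.
Proof. by rewrite /eps lef_pV2 ?posrE ?ltr0n// ler_nat ltnS. Qed.

(** The usual ultrametric of the Baire space pulled back along [c], so that balls are cylinders. *)
Definition code_dist (x y : X) : R :=
  if pselect (exists n, c x n != c y n) is left H then eps (ex_minn H) else 0.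

Let code_dist_ge0 x y : 0 <= code_dist x y.
Proof. by rewrite /code_dist; case: pselect => // H; exact: ltW. Qed.

Lemma code_dist_lt x y n : code_dist x y < eps n <-> agree n.+1 (c x) (c y).
Proof.
rewrite /code_dist; case: pselect => [H|nH]; last first.
  split=> // _ i _; apply/eqP; apply: contrapT => /negP xy.
  by apply: nH; exists i.
case: ex_minnP => m xym mmin; rewrite ltNge eps_ler -ltnNge; split => [nm i|xy].
  rewrite ltnS => ilen; apply/eqP; apply: contrapT => /negP /mmin.
  by rewrite leqNgt (leq_ltn_trans ilen).
by rewrite ltnNge; apply/negP => mn; move: xym; rewrite xy// eqxx.
Qed.

Let code_dist_ge x y n : c x n <> c y n -> eps n <= code_dist x y.
Proof. by move=> xy; rewrite leNgt; apply/negP => /code_dist_lt/(_ n (ltnSn n)). Qed.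

Let code_distxx x : code_dist x x = 0.
Proof.
rewrite /code_dist; case: pselect => // H; exfalso.
by case: H => n; rewrite eqxx.
Qed.

Let code_dist_eq0 x y : code_dist x y = 0 -> x = y.
Proof.
move=> xy; apply: c_inj; apply/funext => n; apply: contrapT => /code_dist_ge.
by rewrite xy leNgt eps_gt0.
Qed.

Let code_dist_sym x y : code_dist x y = code_dist y x.
Proof.
suff H a b : code_dist a b <= code_dist b a by apply/eqP; rewrite eq_le !H.
rewrite {1}/code_dist; case: pselect => // H; case: ex_minnP => m ab _.
by apply: code_dist_ge => ba; move: ab; rewrite ba eqxx.
Qed.

Let code_dist_triangle y x z : code_dist x z <= code_dist x y + code_dist y z.
Proof.
rewrite {1}/code_dist; case: pselect => [H|_]; last by rewrite addr_ge0.
case: ex_minnP => m xz _; have := code_dist_ge0 x y; have := code_dist_ge0 y z.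
have [xy|/eqP xy] := eqVneq (c x m) (c y m).
  have : eps m <= code_dist y z by apply: code_dist_ge => yz; rewrite xy yz eqxx in xz.
  lra.
have := code_dist_ge xy; lra.
Qed.

HB.instance Definition _ := Choice.on (code_metric R c_inj).
HB.instance Definition _ := @isMetric.Build R (code_metric R c_inj) code_dist
  code_distxx code_dist_eq0 code_dist_sym code_dist_triangle.

Lemma code_nbhsP (x : code_metric R c_inj) (U : set (code_metric R c_inj)) :
  nbhs x U <-> exists n, forall y, agree n (c x) (c y) -> U y.
Proof.
rewrite -nbhs_ballE; split => [[e /= e0 eU]|[n nU]].
  have [N _ HN] := near_infty_natSinv_lt (PosNum e0).
  exists N.+1 => y /code_dist_lt xy; apply: eU; rewrite ballEmdist /=.
  exact: lt_trans xy (HN N (leqnn N)).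
exists (eps n) => //= y; rewrite ballEmdist /= => /code_dist_lt xy.
by apply: nU => i ilt; apply: xy; rewrite ltnS ltnW.
Qed.

Definition has_prefix (s : seq nat) (x : X) : Prop :=
  forall i, (i < size s)%N -> c x i = nth 0%N s i.

Lemma has_prefix_mkseq n x y : has_prefix (mkseq (c x) n) y <-> agree n (c x) (c y).
Proof.
by split=> H i; have := H i; rewrite size_mkseq => {}H ilt;
  move: (H ilt); rewrite nth_mkseq// => ->.
Qed.

Hypothesis c_closed :
  forall a, (forall n, exists x, agree n a (c x)) -> exists x, c x = a.

(** One point for each realised finite prefix gives a dense set. Along a Cauchy sequence each
    coordinate of the code stabilises, and [c_closed] puts the limit in the range of [c]. *)
Lemma code_metric_polish : polish (code_metric R c_inj).
Proof.
split.
  pose pick (s : seq nat) : code_metric R c_inj := xget point [set x | has_prefix s x].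
  exists (range pick).
    exact: sub_countable (card_image_le _ _) (countableP _).
  move=> U [x Ux]; rewrite openE => /(_ x Ux)/code_nbhsP[n nU].
  exists (pick (mkseq (c x) n)); split; last by exists (mkseq (c x) n).
  apply: nU; apply/has_prefix_mkseq.
  apply: (@xgetPex X point [set y | has_prefix (mkseq (c x) n) y]).
  by exists x; apply/has_prefix_mkseq.
move=> u /cauchyP uC.
have /choice[N HN] n : exists N, forall m, (N <= m)%N -> agree n (c (u N)) (c (u m)).
  have [x [N _ HN]] := uC (eps n) (eps_gt0 n).
  exists N => m Nm i ilt.
  have Hx k : (N <= k)%N -> c x i = c (u k) i.
    move=> Nk; have := HN k Nk; rewrite /= ballEmdist /= => /code_dist_lt.
    by apply; rewrite ltnS ltnW.
  by rewrite -!Hx.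
pose a i := c (u (N i.+1)) i.
have aE n m : (forall i, (i < n)%N -> (N i.+1 <= m)%N) -> agree n a (c (u m)).
  by move=> nm i ilt; apply: (HN i.+1); rewrite ?nm.
pose M n := \max_(i < n) N i.+1.
have ME n m : (M n <= m)%N -> agree n a (c (u m)).
  move=> Mm; apply: aE => i ilt; apply: leq_trans Mm.
  exact: (@leq_bigmax _ (fun i : 'I_n => N i.+1) (Ordinal ilt)).
have [|x xa] := c_closed (a := a); first by move=> n; exists (u (M n)); exact: ME.
exists x => U /code_nbhsP[n nU]; exists (M n) => // m /= Mm.
by apply: nU; rewrite xa; exact: ME.
Qed.

End CodeMetric.

Lemma measurable_has_prefix d (X : measurableType d) (c : X -> nat -> nat) s :
  (forall k j, measurable [set x | c x k = j]) ->
  measurable [set x | has_prefix c s x].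
Proof.
move=> mc; apply: measurable_all => i; apply: measurable_imply => //.
exact: measurable_const.
Qed.

(** Cylinders are open, and open sets are countable unions of sets given by a finite prefix, so the
    Borel sets of the code metric are the measurable sets. *)
Lemma closed_code_standard_borel (R : realType) d (X : measurableType d)
    (c : X -> nat -> nat) : injective c ->
  (forall k j, measurable [set x | c x k = j]) ->
  measurable `<=` <<s cylinders c >> ->
  (forall a, (forall n, exists x, agree n a (c x)) -> exists x, c x = a) ->
  standard_borel R X.
Proof.
move=> c_inj mc csub c_closed.
exists (code_metric R c_inj), id; split; first exact: code_metric_polish.
  by exists id.
move=> B; rewrite preimage_id; split.
  move: B; apply: smallest_sub; first exact: sigma_algebra_measurable.
  move=> U oU.
  have -> : U = [set x | exists s,
      (forall y, has_prefix c s y -> U y) /\ has_prefix c s x].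
    apply/seteqP; split => x /=; last by move=> [s [H xs]]; exact: H.
    move=> Ux; move: oU; rewrite openE => /(_ x Ux)/code_nbhsP[n nU].
    exists (mkseq (c x) n); split; last exact/has_prefix_mkseq.
    by move=> y /has_prefix_mkseq; exact: nU.
  apply: measurable_ex => s; apply: measurable_and; first exact: measurable_const.
  exact: measurable_has_prefix.
move=> /csub; move: B; apply: sub_sigma_algebra2 => _ [k [j ->]].
rewrite openE => x /= xj; apply/code_nbhsP; exists k.+1 => y /= xy.
by rewrite -xy.
Qed.

(** * The space of countable groups *)

Notation baire := (g_sigma_algebraType (cylinders (@id (nat -> nat)))).

Lemma measurable_baire k j : measurable [set a : baire | a k = j].
Proof. by apply: sub_sigma_algebra; exists k, j. Qed.

Lemma standard_borel_baire (R : realType) : standard_borel R baire.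
Proof.
apply: (@closed_code_standard_borel R _ baire id) => //.
- exact: measurable_baire.
- by move=> a _; exists a.
Qed.

Lemma open_graph_of t : open [set G : set_type group_graphs | graph_of G t].
Proof.
have -> : [set G : set_type group_graphs | graph_of G t] =
    @set_val _ group_graphs @^-1` (proj t @^-1` [set true] : set cantor_N3).
  by apply/seteqP; split.
apply: open_comp => [G _|]; first exact: initial_continuous.
apply: open_comp => [g _|]; first exact: proj_continuous.
exact: discrete_open.
Qed.

Lemma open_group_graphs (U : set (set_type group_graphs)) (G : set_type group_graphs) :
  open U -> U G -> exists n : nat,
    forall H, (forall t, (pickle t < n)%N -> graph_of G t = graph_of H t) -> U H.
Proof.
move=> [W oW <-] WG.
(* The filter of agreement with [G] on finitely many coordinates; its convergence in the product
   topology is checked coordinate by coordinate. *)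
pose F : set_system cantor_N3 := filter_from [set: nat]
  (fun n => [set g | forall t, (pickle t < n)%N -> set_val G t = g t]).
have FF : Filter F.
  apply: filter_from_filter; first by exists 0%N.
  move=> m n _ _; exists (maxn m n) => // g Hg.
  by split => t tlt; apply: Hg; rewrite leq_max tlt ?orbT.
have : F --> (set_val G : cantor_N3).
  apply/cvg_sup => i A [B [[C oC <-] Ci] BA].
  by exists (pickle i).+1 => // g Hg; apply: BA; rewrite /= -Hg.
have nW : nbhs (set_val G : cantor_N3) W by move: oW; rewrite openE; apply.
by move=> /(_ W nW)[n _ HW]; exists n => H GH; exact: HW.
Qed.

Lemma measurable_graph_of t : measurable [set G : group_space | graph_of G t].
Proof. by apply: sub_sigma_algebra; exact: open_graph_of. Qed.

(** Products, inverses ([inr (Some x)]) and the unit ([inr None]). Naming unit and inverses turns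
    the group axioms into equations, hence closed conditions, whereas their mere existence is not a
    closed condition on the multiplication. *)
Definition group_op : countType := (nat * nat + option nat)%type.

Record group_ops (c : group_op -> nat) : Prop := GroupOps {
  opsA : forall x y z, c (inl (x, c (inl (y, z)))) = c (inl (c (inl (x, y)), z));
  ops1g : forall x, c (inl (c (inr None), x)) = x;
  opsg1 : forall x, c (inl (x, c (inr None))) = x;
  opsVg : forall x, c (inl (c (inr (Some x)), x)) = c (inr None);
  opsgV : forall x, c (inl (x, c (inr (Some x)))) = c (inr None) }.

Lemma group_ops_unique c c' : group_ops c -> group_ops c' ->
  (forall x y, c (inl (x, y)) = c' (inl (x, y))) -> c = c'.
Proof.
move=> Oc Oc' mulE; have oneE : c (inr None) = c' (inr None).
  by rewrite -(ops1g Oc' (c (inr None))) -mulE (opsg1 Oc).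
apply/funext => -[[x y]//|[x|//]].
rewrite -(opsg1 Oc (c (inr (Some x)))) oneE -(opsgV Oc' x) -!mulE (opsA Oc).
by rewrite (opsVg Oc) (ops1g Oc).
Qed.

Lemma group_spaceP (G : group_space) : exists c, group_ops c /\
  forall x y z, graph_of G (x, y, z) = (c (inl (x, y)) == z).
Proof.
have [mul [mulA [e [mul1 mulg1 mulV]]] GE] := set_mem (valP G).
have [inv invE] := choice mulV.
exists (fun t => match t with
  | inl xy => mul xy.1 xy.2 | inr None => e | inr (Some x) => inv x end).
by split => //; split => //= x; have [] := invE x.
Qed.

Definition ops (G : group_space) : group_op -> nat := sval (cid (group_spaceP G)).

Lemma opsP G : group_ops (ops G).
Proof. exact: (svalP (cid (group_spaceP G))).1. Qed.

Lemma graph_of_ops G x y z : graph_of G (x, y, z) = (ops G (inl (x, y)) == z).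
Proof. exact: (svalP (cid (group_spaceP G))).2. Qed.

Lemma group_space_of_ops c : group_ops c -> exists G, ops G = c.
Proof.
move=> Oc; pose g : cantor_N3 := fun t => c (inl t.1) == t.2.
have gP : g \in group_graphs.
  apply/mem_set; exists (fun x y => c (inl (x, y))) => //; split.
    exact: opsA.
  exists (c (inr None)); split; [exact: ops1g|exact: opsg1|].
  by move=> x; exists (c (inr (Some x))); split; [exact: opsVg|exact: opsgV].
exists (exist _ g gP : group_space); apply: group_ops_unique => //; first exact: opsP.
move=> x y; apply/eqP; rewrite -graph_of_ops.
exact: eqxx.
Qed.

Definition group_code (G : group_space) (n : nat) : nat :=
  if pickle_inv n is Some t then ops G t else 0%N.

Lemma group_code_pickle G t : group_code G (pickle t) = ops G t.
Proof. by rewrite /group_code pickleK_inv. Qed.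

Lemma group_code_inj : injective group_code.
Proof.
move=> G H GH; apply: val_inj; apply/funext => -[[x y] z].
rewrite -[LHS]/(graph_of G _) -[RHS]/(graph_of H _) !graph_of_ops.
by rewrite -!group_code_pickle GH.
Qed.

(** The unit is the only idempotent, which defines it from the graph without a quantifier. *)
Lemma ops1E G j : ops G (inr None) = j <-> graph_of G (j, j, j).
Proof.
have O := opsP G; rewrite graph_of_ops; split=> [<-|/eqP jj].
  by rewrite (ops1g O).
by rewrite -(opsVg O j) -[in X in inl (_, X)]jj (opsA O) (opsVg O) (ops1g O).
Qed.

Lemma opsVE G i j : ops G (inr (Some i)) = j <-> graph_of G (i, j, ops G (inr None)).
Proof.
have O := opsP G; rewrite graph_of_ops; split=> [<-|/eqP ij].
  by rewrite (opsgV O).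
by rewrite -(opsg1 O (ops G (inr (Some i)))) -ij (opsA O) (opsVg O) (ops1g O).
Qed.

Section MeasurableCode.
Context d (T : measurableType d) (S : T -> group_space).
Hypothesis mS : forall t, measurable [set x | graph_of (S x) t].

Lemma measurable_ops t j : measurable [set x | ops (S x) t = j].
Proof.
case: t => [[x y]|[i|]].
- rewrite (_ : mkset _ = [set u | graph_of (S u) (x, y, j)])//.
  by apply/seteqP; split => u /=; rewrite graph_of_ops => /eqP.
- rewrite (_ : mkset _ =
    [set u | exists e, graph_of (S u) (e, e, e) /\ graph_of (S u) (i, j, e)]).
    by apply: measurable_ex => e; exact: measurable_and.
  apply/seteqP; split => u /=.
    by move=> /opsVE ij; eexists; split; [exact/ops1E|].
  by move=> [e [/ops1E <-]] /opsVE.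
- rewrite (_ : mkset _ = [set u | graph_of (S u) (j, j, j)])//.
  by apply/seteqP; split => u /ops1E.
Qed.

Lemma measurable_group_code k j : measurable [set x | group_code (S x) k = j].
Proof.
rewrite /group_code; case: pickle_inv => [t|]; first exact: measurable_ops.
exact: measurable_const.
Qed.

End MeasurableCode.

(** An open set is a countable union of sets prescribing finitely many values of the graph, and each
    such value is decided by one coordinate of the code. *)
Lemma group_space_cylinders :
  (measurable : set (set group_space)) `<=` <<s cylinders group_code >>.
Proof.
apply: smallest_sub; first exact: smallest_sigma_algebra.
move=> U oU.
have mg t (b : bool) : @measurable _ (g_sigma_algebraType (cylinders group_code))
    [set G | graph_of G t = b].
  case: t => -[x y] z.
  have mz : @measurable _ (g_sigma_algebraType (cylinders group_code))
      [set G | graph_of G (x, y, z)].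
    apply: sub_sigma_algebra; exists (pickle (inl (x, y) : group_op)), z.
    apply/seteqP; split => G /=; rewrite graph_of_ops group_code_pickle.
      by move/eqP.
    by move=> ->.
  case: b => //; rewrite (_ : mkset _ = [set G | ~ graph_of G (x, y, z)]).
    exact: measurable_not.
  by apply/seteqP; split => G /=; [move=> ->|move/negP/negbTE].
pose fits (s : seq bool) (G : group_space) :=
  forall t, (pickle t < size s)%N -> graph_of G t = nth false s (pickle t).
have -> : U = [set G | exists s, (forall H, fits s H -> U H) /\ fits s G].
  apply/seteqP; split => G /=; last by move=> [s [H Gs]]; exact: H.
  move=> UG; have [n nU] := open_group_graphs oU UG.
  pose s := mkseq (fun i => if unpickle i is Some t then graph_of G t else false) n.
  have sE t : (pickle t < n)%N -> nth false s (pickle t) = graph_of G t.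
    by move=> tn; rewrite nth_mkseq// pickleK.
  exists s; split; last by move=> t; rewrite size_mkseq => /sE ->.
  move=> H Hs; apply: nU => t tn; rewrite -sE// Hs// size_mkseq//.
apply: (@measurable_ex _ (g_sigma_algebraType (cylinders group_code))) => s.
apply: (@measurable_and _ (g_sigma_algebraType (cylinders group_code))).
  exact: (@measurable_const _ (g_sigma_algebraType (cylinders group_code))).
apply: (@measurable_all _ (g_sigma_algebraType (cylinders group_code))) => t.
apply: (@measurable_imply _ (g_sigma_algebraType (cylinders group_code))) => //.
exact: (@measurable_const _ (g_sigma_algebraType (cylinders group_code))).
Qed.

Lemma measurable_fun_group_space d (T : measurableType d) (S : T -> group_space) :
  (forall t, measurable [set x | graph_of (S x) t]) -> measurable_fun setT S.
Proof.
move=> mS _ B /group_space_cylinders; rewrite setTI; move: B; apply: smallest_sub.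
  exact/sigma_algebra_preimage_system/sigma_algebra_measurable.
by move=> _ [k [j ->]]; exact: measurable_group_code.
Qed.

(** An instance of a group axiom involves finitely many values of [a], and on these [a] agrees with
    a genuine group. *)
Lemma group_code_closed a :
  (forall n, exists G, agree n a (group_code G)) -> exists G, group_code G = a.
Proof.
move=> aG; have [c cE] : exists c : group_op -> nat, forall t, c t = a (pickle t).
  by exists (fun t => a (pickle t)).
have cG (l : seq group_op) : exists G, forall t, t \in l -> c t = ops G t.
  have [G Ga] := aG (\max_(t <- l) (pickle t).+1); exists G => t tl.
  by rewrite -group_code_pickle cE Ga// (leq_bigmax_seq t).
(* The same fact as a nested conjunction, which can be destructed for explicit lists. *)
have {}cG (l : seq group_op) :
    exists G, foldr (fun t Q => c t = ops G t /\ Q) True l.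
  have [G GE] := cG l; exists G; elim: l GE => //= t l IH GE.
  split; first by apply: GE; exact: mem_head.
  by apply: IH => u ul; apply: GE; rewrite inE ul orbT.
have Oc : group_ops c.
  split=> [x y z|x|x|x|x].
  - have [G [e1 [e2 [e3 [e4 _]]]]] := cG [:: inl (y, z); inl (x, c (inl (y, z)));
      inl (x, y); inl (c (inl (x, y)), z)].
    by rewrite e2 e4 e1 e3; exact: opsA (opsP G) _ _ _.
  - have [G [e1 [e2 _]]] := cG [:: inr None; inl (c (inr None), x)].
    by rewrite e2 e1; exact: ops1g (opsP G) _.
  - have [G [e1 [e2 _]]] := cG [:: inr None; inl (x, c (inr None))].
    by rewrite e2 e1; exact: opsg1 (opsP G) _.
  - have [G [e1 [e2 [e3 _]]]] :=
      cG [:: inr None; inr (Some x); inl (c (inr (Some x)), x)].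
    by rewrite e3 e2 e1; exact: opsVg (opsP G) _.
  - have [G [e1 [e2 [e3 _]]]] :=
      cG [:: inr None; inr (Some x); inl (x, c (inr (Some x)))].
    by rewrite e3 e2 e1; exact: opsgV (opsP G) _.
have [G GE] := group_space_of_ops Oc; exists G; apply/funext => n.
rewrite /group_code GE; case E : pickle_inv => [t|].
  rewrite cE; congr a; move/(congr1 (oapp pickle n)): E => /= <-.
  by rewrite pickle_invK.
(* At positions coding no operation every group code is 0, hence so is [a]. *)
by have [H /(_ n (ltnSn n))] := aG n.+1; rewrite /group_code E.
Qed.

Lemma standard_borel_group_space (R : realType) : standard_borel R group_space.
Proof.
apply: closed_code_standard_borel group_code_inj _ _ group_code_closed.
  exact: measurable_group_code measurable_graph_of.
exact: group_space_cylinders.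
Qed.

(** * Embeddability is an analytic quasi-order *)

Lemma analytic_group_embeddable (R : realType) :
  analytic R [set p : group_space * group_space | group_embeddable p.1 p.2].
Proof.
exists _, baire; split; first exact: standard_borel_baire.
pose T := (group_space * group_space * baire)%type.
have mf k j : measurable [set p : T | p.2 k = j].
  have m : measurable_fun setT (snd : T -> baire) by exact: measurable_snd.
  by rewrite -[X in measurable X]setTI; exact: (m measurableT _ (measurable_baire k j)).
have m1 t : measurable [set p : T | graph_of p.1.1 t].
  have m : measurable_fun setT (fst \o fst : T -> group_space).
    exact: measurableT_comp.
  by rewrite -[X in measurable X]setTI; exact: (m measurableT _ (measurable_graph_of t)).
have m2 t : measurable [set p : T | graph_of p.1.2 t].
  have m : measurable_fun setT (snd \o fst : T -> group_space).
    exact: measurableT_comp.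
  by rewrite -[X in measurable X]setTI; exact: (m measurableT _ (measurable_graph_of t)).
(* Quantifying over the values of the embedding leaves only conditions at fixed arguments, which are
   measurable. *)
exists [set p : T | (forall xy : nat * nat, forall j,
     p.2 xy.1 = j -> p.2 xy.2 = j -> xy.1 = xy.2) /\
   (forall t : nat * nat * nat, graph_of p.1.1 t ->
     forall t' : nat * nat * nat, p.2 t.1.1 = t'.1.1 -> p.2 t.1.2 = t'.1.2 ->
       p.2 t.2 = t'.2 -> graph_of p.1.2 t')].
  apply: measurable_and.
    apply: measurable_all => xy; apply: measurable_all => j.
    do 2 (apply: measurable_imply => //); exact: measurable_const.
  apply: measurable_all => t; apply: measurable_imply => //.
  by apply: measurable_all => t'; do 3 (apply: measurable_imply => //).
apply/seteqP; split => -[G H] /=.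
  move=> [f f_inj fH]; exists ((G, H), f) => //=; split.
    by move=> [x y] j /= <- /f_inj.
  by move=> [[x y] z] /fH /= GH [[x' y'] z'] /= <- <- <-.
move=> [[[G' H'] f] /= [f_inj fH] [<- <-]]; exists f.
  by move=> x y xy; exact: (f_inj (x, y) _ xy erefl).
by move=> x y z /fH /(_ (f x, f y, f z)); exact.
Qed.

Lemma analytic_quasi_order_group_embeddable (R : realType) :
  analytic_quasi_order R group_embeddable.
Proof.
split; [exact: standard_borel_group_space| | |exact: analytic_group_embeddable].
  by move=> G; exists id.
move=> G H K [f f_inj fH] [g g_inj gK]; exists (g \o f); first exact: inj_comp.
by move=> x y z /fH /gK.
Qed.

(** * The forest of chains *)

Lemma take_mkseq (T : Type) (f : nat -> T) m n : (m <= n)%N ->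
  take m (mkseq f n) = mkseq f m.
Proof. by move=> mn; rewrite /mkseq -map_take take_iota (minn_idPl mn). Qed.

Lemma map_mkseq (T U : Type) (h : T -> U) (f : nat -> T) n :
  [seq h t | t <- mkseq f n] = mkseq (h \o f) n.
Proof. by rewrite /mkseq -map_comp. Qed.

Lemma mkseq_eqP (T : Type) (f g : nat -> T) n : mkseq f n = mkseq g n -> agree n f g.
Proof.
move=> fg i ilt; rewrite -(nth_mkseq (f 0%N) f ilt) fg.
by rewrite nth_mkseq.
Qed.

Lemma coherent_limit (T : Type) (s : nat -> seq T) :
  (forall n, size (s n) = n) -> (forall n, take n (s n.+1) = s n) ->
  exists f, forall n, s n = mkseq f n.
Proof.
(* A default element of [T] comes from [s 1]; the limit takes its [i]-th value from [s i.+1], the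
   first list long enough. *)
move=> ss st; have t0 : T by have := ss 1%N; case: (s 1%N) => // t _ _; exact: t.
exists (fun i => nth t0 (s i.+1) i) => n.
elim: n => [|n IH]; first by apply/size0nil; rewrite ss.
rewrite -[LHS](cat_take_drop n) st IH -addn1 /mkseq iotaD map_cat /= add0n.
by rewrite addn1 (drop_nth t0) ?ss// drop_oversize ?ss.
Qed.

Section ChainForest.
Variable K : (nat -> nat * (nat * nat)) -> (nat -> nat) -> Prop.

Definition column : countType := seq (nat * (nat * nat)).
(** A level and one column per link, the last link first. The level is stored because a chain
    without links does not show it. *)
Definition node : countType := (nat * seq column)%type.
Definition label : countType := seq nat.

Definition K_prefix (c : column) (v : label) : Prop :=
  exists g b, [/\ K g b, c = mkseq g (size v) & v = mkseq b (size v)].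

(** Follows the links backwards from [v]: the first components of a column approximate the preceding
    point, and [l] is where the chain starts. Each link is approximated separately. *)
Fixpoint chain (v : label) (cols : seq column) (l : label) : Prop :=
  if cols is c :: cols' then
    K_prefix c v /\ chain [seq t.1 | t <- c] cols' l
  else v = l.

(* A node of level n is the level-n approximation of a finite K-chain ending at a. *)
Definition chain_node (a : nat -> nat) (s : node) (l : label) : Prop :=
  chain (mkseq a s.1) s.2 l.

Definition node_level (s : node) : nat := s.1.

Definition node_parent (s : node) : node :=
  (s.1.-1, [seq take s.1.-1 c | c <- s.2]).

Lemma chain_size v cols l : chain v cols l -> size l = size v.
Proof.
elim: cols v => [|c cols IH] v /=; first by move=> ->.
by move=> [[g [b [_ cE _]]] /IH ->]; rewrite size_map cE size_mkseq.
Qed.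

(** Appends to the chain the link given by [g], truncated to the level of the node. *)
Definition node_cons (g : nat -> nat * (nat * nat)) (s : node) : node :=
  (s.1, mkseq g s.1 :: s.2).

Lemma node_cons_inj g : injective (node_cons g).
Proof. by move=> [m cs] [n ds] [-> _ ->]. Qed.

Lemma node_cons_parent g s :
  node_parent (node_cons g s) = node_cons g (node_parent s).
Proof. by rewrite /node_parent /node_cons /= take_mkseq// leq_pred. Qed.

Lemma chain_node_cons g b s l : K g b ->
  chain_node (fst \o g) s l -> chain_node b (node_cons g s) l.
Proof.
move=> Kgb; rewrite /chain_node /= => H; split; last by rewrite map_mkseq.
by exists g, b; rewrite size_mkseq.
Qed.

Hypothesis K_closed : closed_rel K.

(* An infinite branch of the forest is a genuine finite K-chain from a' to a. *)
Lemma chain_branch (E : (nat -> nat) -> (nat -> nat) -> Prop) :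
  (forall a, E a a) ->
  (forall g b a', E a' (fst \o g) -> K g b -> E a' b) ->
  forall a a' (zeta : nat -> node),
    (forall n, chain_node a (zeta n) (mkseq a' n)) ->
    (forall n, node_parent (zeta n.+1) = zeta n) -> E a' a.
Proof.
move=> E_refl E_step a a' zeta zetaM zetaP.
have lev n : (zeta n).1 = n.
  by have := chain_size (zetaM n); rewrite !size_mkseq.
pose cols n := (zeta n).2.
have colsM n : chain (mkseq a n) (cols n) (mkseq a' n).
  by have := zetaM n; rewrite /chain_node lev.
have colsP n : [seq take n c | c <- cols n.+1] = cols n.
  by have /(congr1 snd) := zetaP n; rewrite /= lev.
move: (cols) colsM colsP => {zeta zetaM zetaP lev} {}cols.
(* Taking parents preserves the number of columns, so it is constant along the branch; the induction
   is on this number. *)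
have [k kE] : exists k, size (cols 0%N) = k by exists (size (cols 0%N)).
elim: k cols a kE => [|k IH] cols a kE colsM colsP.
  have cols0 n : cols n = [::].
    elim: n => [|n IH]; first exact/size0nil.
    by apply/size0nil; have := congr1 size (colsP n); rewrite IH size_map.
  suff -> : a = a' by exact: E_refl.
  apply/funext => i; have := colsM i.+1; rewrite cols0 /= => /mkseq_eqP.
  by apply; exact: ltnSn.
have cons n : exists c r, cols n = c :: r.
  suff : size (cols n) = k.+1 by case: (cols n) => // c r _; exists c, r.
  elim: n => [//|n IHn]; have := congr1 size (colsP n).
  by rewrite size_map IHn.
have {cons}[c /choice[r crE]] := choice cons.
have cs n : size (c n) = n.
  have := colsM n; rewrite crE /= => -[[g [b [_ -> _]]] _].
  by rewrite !size_mkseq.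
have ct n : take n (c n.+1) = c n.
  by have := colsP n; rewrite !crE /= => -[].
have [g gE] := coherent_limit cs ct.
apply: (E_step g).
  apply: (IH r).
  - by move: kE; rewrite crE => -[].
  - by move=> n; have := colsM n; rewrite crE gE /= => -[_]; rewrite map_mkseq.
  - by move=> n; have := colsP n; rewrite !crE => -[].
(* Every prefix of the pair [g], [a] extends to a point of the closed relation [K], so the limit
   link is genuine. *)
apply: K_closed => n; have := colsM n; rewrite crE /= => -[[g' [b' [Kgb]]] + + _].
rewrite size_mkseq gE => /mkseq_eqP gg' /mkseq_eqP bb'.
by exists g', b'.
Qed.

End ChainForest.

Lemma measurable_mkseq d (X : measurableType d) (phi : X -> nat -> nat) n
    (Q : set (seq nat)) : (forall k j, measurable [set x | phi x k = j]) ->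
  measurable [set x | Q (mkseq (phi x) n)].
Proof.
move=> mphi.
rewrite (_ : mkset _ = [set x | exists s, (Q s /\ size s = n) /\ has_prefix phi s x]).
  apply: measurable_ex => s; apply: measurable_and; first exact: measurable_const.
  exact: measurable_has_prefix.
apply/seteqP; split => x /=.
  move=> Qx; exists (mkseq (phi x) n); rewrite size_mkseq; split => //.
  exact/has_prefix_mkseq.
move=> [s [[Qs sn] xs]]; rewrite (_ : mkseq _ _ = s)//.
apply: (@eq_from_nth _ 0%N); rewrite size_mkseq//.
by move=> i ilt; rewrite nth_mkseq// xs// sn.
Qed.

Lemma measurable_forest_group d (X : measurableType d) (N L : countType)
    (lev : N -> nat) (par : N -> N) (M : X -> N -> L -> Prop) v :
  (forall s l, measurable [set x | M x s l]) ->
  measurable [set x | forest_group lev par (M x) v].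
Proof.
move=> mM; rewrite (_ : mkset _ = [set x | exists r : seq (gen_index N L),
   (forall g, g \in r -> gen_valid (M x) g) /\ v = \sum_(g <- r) gen lev par g]).
  apply: measurable_ex => r; apply: measurable_and; last exact: measurable_const.
  apply: measurable_all => g; apply: measurable_imply; first exact: measurable_const.
  exact: mM.
by apply/seteqP; split => x [r]; [exists r|case=> *; exists r].
Qed.

(** * Infinite subgroups as points of the space of groups *)

Section SubgroupSpace.
Variables (V : countZmodType).

Definition infinite_subgroup (A : set V) : Prop :=
  [/\ exists2 f : nat -> V, injective f & forall n, A (f n), A 0,
      forall u v, A u -> A v -> A (u + v) & forall u, A u -> A (- u)].

Definition subgroup_graph (A : set V) : cantor_N3 :=
  fun t => subgroup_mul A t.1.1 t.1.2 == t.2.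

Lemma subgroup_graphP A : infinite_subgroup A -> subgroup_graph A \in group_graphs.
Proof.
move=> [inf A0 AD AN]; apply/mem_set; exists (subgroup_mul A) => //.
exact: subgroup_mul_law.
Qed.

Definition subgroup_space A (hA : infinite_subgroup A) : group_space :=
  exist (fun g => g \in group_graphs) _ (subgroup_graphP hA).

Lemma graph_of_subgroup A (hA : infinite_subgroup A) i j k :
  graph_of (subgroup_space hA) (i, j, k) = (subgroup_mul A i j == k).
Proof. by []. Qed.

(** Conjugating by the enumerations exchanges homomorphisms on [nat] with maps additive on [A]; [h]
    is unconstrained outside [A]. *)
Lemma subgroup_embeddable A B (hA : infinite_subgroup A) (hB : infinite_subgroup B) :
  group_embeddable (subgroup_space hA) (subgroup_space hB) <->
  exists h : V -> V, [/\ forall v, A v -> B (h v),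
    forall u v, A u -> A v -> h u = h v -> u = v &
    forall u v, A u -> A v -> h (u + v) = h u + h v].
Proof.
have [infA A0 AD AN] := hA; have [infB B0 BD BN] := hB.
have eltA i := (eltP infA i).1; have eltB i := (eltP infB i).1.
split.
  move=> [f f_inj fM].
  have fmul i j : f (subgroup_mul A i j) = subgroup_mul B (f i) (f j).
    apply/eqP; rewrite eq_sym -(graph_of_subgroup hB); apply: fM.
    by rewrite graph_of_subgroup.
  exists (fun v => elt B (f (rank A v))); split => [v Av|u v Au Av|u v Au Av].
  - exact: eltB.
  - move=> /(congr1 (rank B)); rewrite !(eltP infB _).2 => /f_inj.
    exact: rank_inj.
  - rewrite -(elt_mul infB BD) -fmul; congr (elt B (f _)).
    by rewrite /subgroup_mul !rankK.
move=> [h [hAB h_inj hD]]; exists (fun i => rank B (h (elt A i))).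
  move=> i j ij.
  have e := h_inj _ _ (eltA i) (eltA j)
    (rank_inj (hAB _ (eltA i)) (hAB _ (eltA j)) ij).
  by rewrite -(eltP infA i).2 e (eltP infA j).2.
move=> i j k; rewrite !graph_of_subgroup => /eqP <-; apply/eqP.
by rewrite (elt_mul infA AD) hD// /subgroup_mul !rankK//; exact: hAB.
Qed.

End SubgroupSpace.

(** * The Borel reduction *)

Theorem theorem5p1 (R : realType) :
  universal_analytic_quasi_order R group_embeddable.
Proof.
split; first exact: analytic_quasi_order_group_embeddable.
move=> d X P Pqo.
have [phi [K [phi_inj mphi Kc KP PK]]] := analytic_quasi_order_code Pqo.
have [_ P_refl P_trans _] := Pqo.
pose M x := chain_node K (phi x).
pose A x : set {poly rat} := forest_group node_level node_parent (M x).
have hA x : infinite_subgroup (A x).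
  split.
  (* The root without links, whose label is the empty sequence, lies in every forest. *)
  - by apply: (@forest_group_infinite _ _ _ _ _ (0%N, [::]) [::]).
  - exact: forest_group0.
  - by move=> u v; exact: forest_groupD.
  - by move=> u; exact: forest_groupN.
have mA v : measurable [set x | A x v].
  apply: measurable_forest_group => s l.
  exact: (measurable_mkseq s.1 [set w | chain K w s.2 l] mphi).
exists (fun x => subgroup_space (hA x)).
  apply: measurable_fun_group_space => -[[i j] k].
  rewrite (_ : mkset _ = [set x | subgroup_mul (A x) i j = k]).
    by apply: measurable_subgroup_mul => // x; have [] := hA x.
  by apply/seteqP; split => x /=; rewrite graph_of_subgroup => /eqP.
move=> x y; rewrite subgroup_embeddable; split.
  move=> /KP[g gx Kg].
  apply: (forest_group_map (f := node_cons g)) => //; first exact: node_cons_inj.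
    by move=> s; exact: node_cons_parent.
  by move=> s l; rewrite /M -gx; exact: chain_node_cons.
move=> [h [hAA h_inj hD]].
have lev_par s : node_level (node_parent s) = (node_level s).-1 by [].
(* The branch without links at [phi x], labelled by the prefixes of [phi x]; the length of such a
   label is the level. *)
have [||||zeta zetaP] := @forest_group_branch node label node_level node_parent lev_par
  (M x) (M y) h hAA h_inj hD (fun n => (n, [::])) (fun n => mkseq (phi x) n).
- by [].
- by [].
- by [].
- by move=> n s /chain_size; rewrite !size_mkseq.
(* [P] seen on codes: vacuous off the range of [phi], and reflexive because [phi] is injective and
   [P] is reflexive. *)
pose E a' a := forall u v, a' = phi u -> a = phi v -> P u v.
suff : E (phi x) (phi y) by exact.
apply: (chain_branch Kc) (zeta) _ _.
- by move=> a u v -> /phi_inj ->.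
- move=> g b a' Eg /PK[u [v [Puv gu bv]]] x' y' xE yE.
  apply: (P_trans _ u); first exact: Eg.
  by have <- : v = y' by apply: phi_inj; rewrite -bv.
- by move=> n; have [] := zetaP n.
- by move=> n; have [] := zetaP n.
Qed.
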